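(* Let $\mathbf Y=\mathbf A(z)+\mathbf B(z)\mathbf Y$ be an irreducible linear well-founded system. Let $\rho_A,\rho_B,\rho_Y$ be the radii of convergence of $\mathbf A,\mathbf B,\mathbf Y$ (the generating function solution) and $\Sigma_A,\Sigma_B,\Sigma_Y$ their sets of dominant singularities. If the largest real eigenvalue of $\mathbf B(\rho_B)$ is smaller than $1$, let $\rho_C:=+\infty$ and $\Sigma_C:=\emptyset$. Otherwise, there exists a unique $\rho_C\in(0,\rho_B]$ such that the largest real eigenvalue of $\mathbf B(\rho_C)$ is $1$; let $q$ be the gcd of the periods of the entries of $\mathbf B$; set $q_B:=q$ if $q\ne0$, and otherwise let $q_B$ be the gcd of the periods of the diagonal entries of $(\mathrm{Id}-\mathbf B)^{-1}$; and let $\Sigma_C:=\{\rho_C\exp(2i\pi k/q_B)\mid k\in\{0,\dots,q_B-1\}\}$. Then $\rho_Y=\min(\rho_A,\rho_B,\rho_C)$ and \[\Sigma_Y\subset\bigcup_{X\in\{A,B,C\},\ \rho_X=\rho_Y}\Sigma_X.\]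
   Context: A system $\mathbf Y=\mathbf H(z,\mathbf Y)$ with $\mathbf H$ analytic near $\mathbf 0\in\mathbb C^{m+1}$ is well founded when (i) each $H_i$ has nonnegative real Taylor coefficients at $\mathbf 0$; (ii) with $\mathbf U^{[0]}=\mathbf 0$, for $k=0,\dots,m$, $(0,\mathbf U^{[k]})$ lies in the domain of convergence of the Taylor series of $\mathbf H$, so that $\mathbf U^{[k+1]}=\mathbf H(0,\mathbf U^{[k]})$ is defined; (iii) $\partial\mathbf H/\partial\mathbf Y$ at $(0,\mathbf U^{[m]})$ is nilpotent. The generating function solution is the unique solution analytic near $0$ with value $\mathbf U^{[m]}$ at $0$. The system is irreducible if it is well founded, zero-free (no coordinate of the solution identically zero), recursive ($\partial\mathbf H/\partial\mathbf Y$ not nilpotent) and its dependency graph (edge $i\to j$ when $H_i$ depends on $Y_j$) is strongly connected. Here $\mathbf H=\mathbf A(z)+\mathbf B(z)\mathbf Y$ with $\mathbf A$ a vector and $\mathbf B$ a matrix of power series. For a nonzero power series $f$, its period is $\gcd(\mathrm{Supp}(f)-\mathrm{val}(f))$, where $\mathrm{Supp}$ is the set of indices of nonzero coefficients and $\mathrm{val}=\min\mathrm{Supp}$ (the period of a monomial is $0$). The radius of convergence of a vector or matrix is the minimum over its entries, and its dominant singularities are the singularities of its entries on the circle of that radius. *)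

(* Defs.v *)
From HB Require Import structures.
From mathcomp Require Import all_boot all_order all_algebra.
From mathcomp Require Import all_classical all_reals all_analysis.
From mathcomp Require Import complex.

Set Implicit Arguments.
Unset Strict Implicit.
Unset Printing Implicit Defensive.

Import Order.TTheory GRing.Theory Num.Theory.
Import numFieldNormedType.Exports.

Local Open Scope classical_set_scope.
Local Open Scope ring_scope.
Local Open Scope complex_scope.

(* A one-field record rather than [nat -> K], because MathComp-Analysis equips
   the latter with the pointwise product. *)
Record fps (K : Type) := Fps { fps_coef :> nat -> K }.

Lemma fpsP (K : Type) (f g : fps K) : (forall n, f n = g n) -> f = g.
Proof. by case: f g => [f] [g] /= fg; congr Fps; apply/funext. Qed.

HB.instance Definition _ (K : Type) := gen_eqMixin (fps K).
HB.instance Definition _ (K : Type) := gen_choiceMixin (fps K).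

Section FpsRing.
Variable K : comNzRingType.
Implicit Types f g h : fps K.

Definition fps_zero : fps K := Fps (fun=> 0).
Definition fps_one : fps K := Fps (fun n => (n == 0%N)%:R).
Definition fps_opp f : fps K := Fps (fun n => - f n).
Definition fps_add f g : fps K := Fps (fun n => f n + g n).
Definition fps_mul f g : fps K := Fps (fun n => \sum_(i < n.+1) f i * g (n - i)%N).

Fact fps_addA : associative fps_add.
Proof. by move=> f g h; apply: fpsP => n /=; rewrite addrA. Qed.
Fact fps_addC : commutative fps_add.
Proof. by move=> f g; apply: fpsP => n /=; rewrite addrC. Qed.
Fact fps_add0 : left_id fps_zero fps_add.
Proof. by move=> f; apply: fpsP => n /=; rewrite add0r. Qed.
Fact fps_addN : left_inverse fps_zero fps_opp fps_add.
Proof. by move=> f; apply: fpsP => n /=; rewrite addNr. Qed.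

HB.instance Definition _ :=
  GRing.isZmodule.Build (fps K) fps_addA fps_addC fps_add0 fps_addN.

Let trunc N f : {poly K} := \poly_(i < N.+1) f i.

Let coef_trunc N f n : (n <= N)%N -> (trunc N f)`_n = f n.
Proof. by move=> nN; rewrite coef_poly ltnS nN. Qed.

Let coef_truncM N f g n : (n <= N)%N ->
  (trunc N f * trunc N g)`_n = fps_mul f g n.
Proof.
move=> nN; rewrite coefM; apply: eq_bigr => i _.
rewrite !coef_trunc //; first exact: leq_trans (leq_subr _ _) nN.
by rewrite (leq_trans _ nN) // -ltnS.
Qed.

Fact fps_mulC : commutative fps_mul.
Proof.
by move=> f g; apply: fpsP => n; rewrite -!(@coef_truncM n) // mulrC.
Qed.

Fact fps_mulA : associative fps_mul.
Proof.
move=> f g h; apply: fpsP => n.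
transitivity ((trunc n f * (trunc n g * trunc n h))`_n).
  rewrite coefM; apply: eq_bigr => i _.
  by rewrite coef_trunc -1?ltnS // coef_truncM // leq_subr.
rewrite mulrA coefM; apply: eq_bigr => i _.
by rewrite coef_trunc ?leq_subr // coef_truncM // -ltnS.
Qed.

Fact fps_mul1 : left_id fps_one fps_mul.
Proof.
move=> f; apply: fpsP => n /=; rewrite big_ord_recl /= subn0 mul1r.
by rewrite big1 ?addr0 // => i _; rewrite mul0r.
Qed.

Fact fps_mulDl : left_distributive fps_mul fps_add.
Proof.
move=> f g h; apply: fpsP => n /=; rewrite -big_split /=.
by apply: eq_bigr => i _; rewrite mulrDl.
Qed.

Fact fps_one_neq0 : fps_one != 0.
Proof.
apply/eqP => /(congr1 (fun f : fps K => f 0%N)) /= /eqP.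
by rewrite oner_eq0.
Qed.

HB.instance Definition _ := GRing.Zmodule_isComNzRing.Build (fps K)
  fps_mulA fps_mulC fps_mul1 fps_mulDl fps_one_neq0.

Definition fps_unit : {pred fps K} := fun f => `[< exists g, g * f = 1 >].
Definition fps_inv f : fps K :=
  if pselect (exists g, g * f = 1) is left e then projT1 (cid e) else f.

Fact fps_mulV : {in fps_unit, left_inverse 1 fps_inv *%R}.
Proof.
move=> f /asboolP fU; rewrite /fps_inv; case: pselect => // e.
exact: projT2 (cid e).
Qed.
Fact fps_unitP f g : g * f = 1 -> fps_unit f.
Proof. by move=> gf; apply/asboolP; exists g. Qed.
Fact fps_inv_out : {in [predC fps_unit], fps_inv =1 id}.
Proof.
move=> f /negP fU; rewrite /fps_inv; case: pselect => // e.
by case: fU; apply/asboolP.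
Qed.

HB.instance Definition _ := GRing.ComNzRing_hasMulInverse.Build (fps K)
  fps_mulV fps_unitP fps_inv_out.

End FpsRing.

Definition is_nilpotent (S : pzRingType) (x : S) : Prop := exists k, x ^+ k = 0.

Section Evaluation.
Variable K : numFieldType.

Definition fps_series (f : fps K) (z : K) : K ^nat :=
  [series f n * z ^+ n]_n.

Definition fps_cvg (f : fps K) (z : K) : Prop := cvgn (fps_series f z).

Definition fps_eval (f : fps K) (z : K) : K := limn (fps_series f z).

Definition mx_cvg p q (M : 'M[fps K]_(p, q)) (z : K) : Prop :=
  forall i j, fps_cvg (M i j) z.

Definition mx_eval p q (M : 'M[fps K]_(p, q)) (z : K) : 'M[K]_(p, q) :=
  map_mx (fps_eval^~ z) M.

End Evaluation.

Section Period.
Variable K : nzRingType.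
Implicit Types f : fps K.

(* Greatest for divisibility, so that the gcd of {0} is 0. *)
Definition gcd_set (S : set nat) : nat :=
  get [set d | (forall s, S s -> (d %| s)%N) /\
               (forall e, (forall s, S s -> (e %| s)%N) -> (e %| d)%N)].

Definition fps_supp f : set nat := [set n | f n != 0].

Definition fps_val f : nat :=
  get [set v | fps_supp f v /\ forall n, fps_supp f n -> (v <= n)%N].

Definition fps_period f : nat :=
  gcd_set [set (n - fps_val f)%N | n in fps_supp f].

End Period.

Section ComplexAnalysis.
Variable R : realType.
Local Notation C := R[i].
Local Notation normc := (@ComplexField.Normc.normc R).

Definition fps_radius (f : fps C) : \bar R :=
  ereal_sup [set (normc z)%:E | z in [set z : C | fps_cvg f z]].

Definition mx_radius p q (M : 'M[fps C]_(p, q)) : \bar R :=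
  \big[mine/+oo%E]_(i < p) \big[mine/+oo%E]_(j < q) fps_radius (M i j).

(* The sum of f on its open disc of convergence continues analytically to a
   neighbourhood of z0; g is the Taylor series at z0 of the continuation.
   Only meant for z0 on the circle of convergence or inside it. *)
Definition regular_at (f : fps C) (z0 : C) : Prop :=
  exists g : fps C, exists2 r : R, 0 < r &
    forall z : C, normc (z - z0) < r ->
      fps_cvg g (z - z0) /\
      (((normc z)%:E < fps_radius f)%E -> fps_eval f z = fps_eval g (z - z0)).

Definition dominant_sing p q (M : 'M[fps C]_(p, q)) : set C :=
  [set z | (normc z)%:E = mx_radius M /\ exists i j, ~ regular_at (M i j) z].

Definition largest_real_eigenvalue n (M : 'M[C]_n) (l : R) : Prop :=
  eigenvalue M l%:C /\ forall l' : R, eigenvalue M l'%:C -> l' <= l.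

Definition expi (t : R) : C := cos t +i* sin t.

End ComplexAnalysis.

Section LinearSystem.
Variables (R : realType) (m : nat).
Local Notation C := R[i].
Local Notation normc := (@ComplexField.Normc.normc R).
Implicit Types (A Y : 'cV[fps C]_m) (B : 'M[fps C]_m).

Definition lin_H A B (z : C) (y : 'cV[C]_m) : 'cV[C]_m :=
  mx_eval A z + mx_eval B z *m y.

(* H is affine in y, so the domain of convergence of its Taylor series is a
   disc in z times all of C^m. *)
Definition lin_domain A B : set (C * 'cV[C]_m) :=
  [set p | ((normc p.1)%:E < mx_radius A)%E /\
           ((normc p.1)%:E < mx_radius B)%E].

(* The matrix dH/dY at the point (z, y); it does not depend on y. *)
Definition lin_jacobian B (z : C) (y : 'cV[C]_m) : 'M[C]_m := mx_eval B z.

Fixpoint lin_U A B (k : nat) : 'cV[C]_m :=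
  if k is k'.+1 then lin_H A B 0 (lin_U A B k') else 0.

(* The order of R[i] is partial: [0 <= c] says that c is real and
   nonnegative. *)
Definition wf_system A B : Prop :=
  [/\ (0 < mx_radius A)%E /\ (0 < mx_radius B)%E,
      (forall i n, 0 <= A i 0 n) /\ (forall i j n, 0 <= B i j n),
      forall k, (k <= m)%N -> lin_domain A B (0, lin_U A B k)
    & is_nilpotent (lin_jacobian B 0 (lin_U A B m))].

(* Analytic germs at 0 are represented by their Taylor series. *)
Definition gf_solution A B Y : Prop :=
  [/\ (0 < mx_radius Y)%E, Y = A + B *m Y & mx_eval Y 0 = lin_U A B m].

Definition zero_free A B : Prop :=
  forall Y, gf_solution A B Y -> forall i, Y i 0 != 0.

Definition dependency B : rel 'I_m := [rel i j | B i j != 0].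

Definition irreducible_system A B : Prop :=
  [/\ wf_system A B, zero_free A B, ~ is_nilpotent B
    & forall i j, connect (dependency B) i j].

(* The largest real eigenvalue of B(rho_B) is smaller than 1. This includes
   that rho_B is finite and that B converges there; otherwise the eigenvalue
   counts as +oo. *)
Definition subcritical B : Prop :=
  exists r : R, [/\ mx_radius B = r%:E, mx_cvg B r%:C &
    exists2 l : R, largest_real_eigenvalue (mx_eval B r%:C) l & l < 1].

Definition is_rhoC B (r : R) : Prop :=
  [/\ 0 < r, (r%:E <= mx_radius B)%E, mx_cvg B r%:C
    & largest_real_eigenvalue (mx_eval B r%:C) 1].

(* Zero entries have no period and are left out. *)
Definition gcd_periods B : nat :=
  \big[gcdn/0%N]_i \big[gcdn/0%N]_(j | B i j != 0) fps_period (B i j).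

Definition qB B : nat :=
  if gcd_periods B != 0%N then gcd_periods B
  else \big[gcdn/0%N]_i fps_period (invmx (1%:M - B) i i).

Definition SigmaC B (r : R) : set C :=
  [set r%:C * expi (2 * pi * k%:R / (qB B)%:R) | k in `I_(qB B)].

End LinearSystem.

(* Main.v *)
Require Import Defs.
From HB Require Import structures.
From mathcomp Require Import all_boot all_order all_algebra.
From mathcomp Require Import all_classical all_reals all_analysis.
From mathcomp Require Import complex ring lra.
Import Order.TTheory GRing.Theory Num.Theory.
Import numFieldNormedType.Exports.
Local Open Scope classical_set_scope.
Local Open Scope ring_scope.

Set Implicit Arguments.
Unset Strict Implicit.
Unset Printing Implicit Defensive.

(** For x > 0 the matrix B(x) is nonnegative and irreducible, so it has positive
    left and right eigenvectors for its largest real eigenvalue lambda(x), and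
    lambda is strictly increasing because some entry of B is not constant.  The
    critical point is the supremum of the x such that B(x) u <= u for some
    positive u: going round a cycle bounds every entry of B(x) for such x, so B
    still converges at the supremum, lambda <= 1 there by left continuity, and
    lambda < 1 only if the supremum is the radius of convergence of B, since
    otherwise convexity of x^n would allow to go further.

    Pairing Y = A + B Y with a left eigenvector bounds the partial sums of Y as
    long as lambda(x) < 1, and forces A = 0 if Y converges where lambda(x) = 1;
    together with the coefficientwise bounds A_i <= Y_i and B_ij Y_j <= Y_i this
    gives the radius of Y.

    At a point z of the circle of convergence where A and B are regular, Y is
    regular as soon as Id - B(z) is invertible.  If y B(z) = y with y <> 0, then
    equality holds in |y| <= |y| B(|z|), so lambda(|z|) = 1 and, with
    w = z / |z|, there are d_i <> 0 such that d_i w^n = d_j whenever B_ij has a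
    nonzero coefficient of index n.  Hence B(w t) is conjugate to B(t) by a
    constant diagonal matrix, and w is a root of unity of order dividing q_B. *)

(** * Absolute convergence in the complex field *)

(** [fps_eval] is a limit, with no content where the series diverges, so every estimate is made on
    the partial sums [psum] of the moduli: absolute convergence is their boundedness, [asum] their
    supremum. As B has nonnegative coefficients, B(x) for real x >= 0 is the real matrix of the
    [asum] of its entries, and order replaces spectral theory: the largest real eigenvalue is built
    as the largest l with l v <= v B(x) for some nonzero v >= 0.

    Both cases of the theorem rest on the same data: a point r > 0 where B converges, with
    eigenvalue l <= 1, such that r is the radius of B if l < 1. The second case is l = 1, and the
    radius and the singularities of Y are computed once for both.

    Regularity of a series at z only compares sums inside the open disc, whereas Id - B(z) lives on
    the circle. B converges absolutely there, because |z| <= r, and Abel's theorem along the radius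
    identifies B(z) with the value at z of the analytic continuation. *)

Section ComplexModulus.
Variable R : realType.
Local Notation C := R[i].
Local Notation K := ((R[i] : numFieldType)).
Local Notation Re := (@complex.Re R).
Local Notation Im := (@complex.Im R).
Local Open Scope complex_scope.
Local Notation normc := (@ComplexField.Normc.normc R).
Implicit Types (z w : C) (u : K^nat).

Lemma normcC z : `|z| = (normc z)%:C.
Proof. by rewrite normc_def; case: z. Qed.

Lemma normc_ge0 z : 0 <= normc z.
Proof. by rewrite -lecR -normcC normr_ge0. Qed.

Lemma normcD z w : normc (z + w) <= normc z + normc w.
Proof. by rewrite -lecR rmorphD /= -!normcC ler_normD. Qed.

Lemma normcM z w : normc (z * w) = normc z * normc w.
Proof. exact: ComplexField.Normc.normcM. Qed.

Lemma normc0 : normc 0 = 0.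
Proof. exact: ComplexField.Normc.normc0. Qed.

Lemma normc1 : normc 1 = 1.
Proof. exact: ComplexField.Normc.normc1. Qed.

Lemma normcN z : normc (- z) = normc z.
Proof. by apply: complexI; rewrite -!normcC normrN. Qed.

Lemma normcB z w : normc (z - w) = normc (w - z).
Proof. by rewrite -normcN opprB. Qed.

Lemma normc_eq0 z : (normc z == 0) = (z == 0).
Proof.
by apply/eqP/eqP => [/ComplexField.Normc.eq0_normc//|->]; rewrite normc0.
Qed.

Lemma normcX z n : normc (z ^+ n) = normc z ^+ n.
Proof.
by elim: n => [|n IH]; rewrite ?expr0 ?normc1 // !exprS normcM IH.
Qed.

Lemma normc_real (x : R) : normc x%:C = `|x|.
Proof. by apply: complexI; rewrite -normcC normc_def /= expr0n addr0 sqrtr_sqr. Qed.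

Lemma normc_ge0_id z : 0 <= z -> z = (normc z)%:C.
Proof. by move=> z0; rewrite -normcC ger0_norm. Qed.

Lemma le_normc z w : 0 <= z -> z <= w -> normc z <= normc w.
Proof.
by move=> z0 zw; rewrite -lecR -!normc_ge0_id // (le_trans z0).
Qed.

Lemma normc_sum (I : Type) (r : seq I) (P : pred I) (F : I -> C) :
  normc (\sum_(i <- r | P i) F i) <= \sum_(i <- r | P i) normc (F i).
Proof.
elim/big_rec2: _ => [|i x z _ zx]; first by rewrite normc0.
by rewrite (le_trans (normcD _ _)) // lerD2l.
Qed.

Lemma normc_Re z : `|Re z| <= normc z.
Proof. by rewrite -lecR -normcC; exact: normc_ge_Re. Qed.

Lemma normc_Im z : `|Im z| <= normc z.
Proof.
case: z => a b /=; rewrite -sqrtr_sqr ler_wsqrtr // lerDr; exact: sqr_ge0.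
Qed.

Lemma normc_Re_Im z : normc z <= `|Re z| + `|Im z|.
Proof.
case: z => a b; have -> : (a +i* b) = a%:C + 'i%C * b%:C.
  by rewrite complexiE; simpc.
rewrite (le_trans (normcD _ _)) // normcM !normc_real /=.
by rewrite ?(expr0n, expr1n, mul0r, mulr0, mul1r, subr0, addr0, add0r, sqrtr1).
Qed.

Lemma cvgC_P u (l : K) :
  u @ \oo --> l <-> (fun n => normc (u n - l)) @ \oo --> (0 : R).
Proof.
split=> [/cvgrPdist_lt ul|/cvgrPdist_lt ul]; apply/cvgrPdist_lt => e e0.
  have /ul : 0 < e%:C by rewrite ltcR.
  apply: filterS => n; rewrite normcC ltcR sub0r normrN ger0_norm ?normc_ge0 //.
  by rewrite normcB.
have er : e = (Re e)%:C by rewrite RRe_real // gtr0_real.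
have /ul : 0 < Re e by rewrite -ltcR -er.
apply: filterS => n; rewrite er normcC ltcR sub0r normrN ger0_norm ?normc_ge0 //.
by rewrite normcB.
Qed.

Lemma cvgC_lim u (l : K) : u @ \oo --> l -> limn u = l.
Proof. exact: (cvg_lim (@norm_hausdorff _ _)). Qed.

Lemma cvgCD (u v : K^nat) (l l' : K) : u @ \oo --> l -> v @ \oo --> l' ->
  (fun n => u n + v n : K) @ \oo --> (l + l' : K).
Proof. exact: cvgD. Qed.

Lemma cvgCB (u v : K^nat) (l l' : K) : u @ \oo --> l -> v @ \oo --> l' ->
  (fun n => u n - v n : K) @ \oo --> (l - l' : K).
Proof. exact: cvgB. Qed.

Lemma cvgCM (u v : K^nat) (l l' : K) : u @ \oo --> l -> v @ \oo --> l' ->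
  (fun n => u n * v n : K) @ \oo --> (l * l' : K).
Proof. exact: cvgM. Qed.

Lemma cvgC_cst (l : K) : (fun=> l) @ \oo --> l.
Proof. exact: cvg_cst. Qed.

Lemma cvgC_squeeze u (l : K) (e : R^nat) : (forall n, normc (u n - l) <= e n) ->
  e @ \oo --> (0 : R) -> u @ \oo --> l.
Proof.
move=> ue e0; apply/cvgC_P.
apply: (@squeeze_cvgr _ _ _ _ (fun=> 0) e) => //; last exact: cvg_cst.
by apply: nearW => n; rewrite normc_ge0 ue.
Qed.

Lemma is_cvgC (u : K^nat) : cvgn (fun n => Re (u n)) -> cvgn (fun n => Im (u n)) ->
  cvgn u.
Proof.
move=> /cvg_ex[/= a ua] /cvg_ex[/= b ub].
apply: (cvgP (a +i* b : K)).
apply: (@cvgC_squeeze _ _ (fun n => `|Re (u n) - a| + `|Im (u n) - b|)).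
  by move=> n; rewrite (le_trans (normc_Re_Im _)) //; case: (u n).
rewrite -[X in _ --> X](addr0 (0 : R)).
have H (v : R^nat) (c : R) : v @ \oo --> c -> (fun n => `|v n - c|) @ \oo --> (0 : R).
  move=> vc; rewrite -[X in _ --> X](@normr0 _ R) -[X in `|X|](subrr c).
  by apply: cvg_norm; apply: cvgB => //; exact: cvg_cst.
by apply: cvgD; exact: H.
Qed.

End ComplexModulus.

Section AbsoluteConvergence.
Variable R : realType.
Local Notation C := R[i].
Local Notation K := ((R[i] : numFieldType)).
Local Open Scope complex_scope.
Local Notation normc := (@ComplexField.Normc.normc R).
Implicit Types (f g : fps C) (x y : R) (z w : C).

Definition psum f x (N : nat) : R := \sum_(k < N) normc (f k) * x ^+ k.
Definition csum f z (N : nat) : C := \sum_(k < N) f k * z ^+ k.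
(** For x >= 0 the partial sums are nondecreasing, so a bound is convergence. Outside [abscvg] the
    supremum below takes a default value and means nothing. *)
Definition abscvg f x : Prop := exists M, forall N, psum f x N <= M.
Definition asum f x : R := sup (range (psum f x)).

Lemma fps_seriesE f z : fps_series f z = csum f z.
Proof. by apply/funext => N; rewrite /fps_series /series /= big_mkord. Qed.

Lemma psum_term_ge0 f x k : 0 <= x -> 0 <= normc (f k) * x ^+ k.
Proof. by move=> x0; rewrite mulr_ge0 ?normc_ge0 ?exprn_ge0. Qed.

Lemma psum_ge0 f x N : 0 <= x -> 0 <= psum f x N.
Proof. by move=> x0; apply: sumr_ge0 => k _; exact: psum_term_ge0. Qed.

Lemma psumS f x N : psum f x N.+1 = psum f x N + normc (f N) * x ^+ N.
Proof. by rewrite /psum big_ord_recr. Qed.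

Lemma csumS f z N : csum f z N.+1 = csum f z N + f N * z ^+ N.
Proof. by rewrite /csum big_ord_recr. Qed.

Lemma psum_nondecreasing f x : 0 <= x -> nondecreasing_seq (psum f x).
Proof.
move=> x0; apply/nondecreasing_seqP => n.
by rewrite psumS lerDl psum_term_ge0.
Qed.

Lemma ler_psum f x y N : 0 <= x -> x <= y -> psum f x N <= psum f y N.
Proof.
move=> x0 xy; apply: ler_sum => k _; rewrite ler_wpM2l ?normc_ge0 //.
by rewrite lerXn2r // nnegrE (le_trans x0).
Qed.

Lemma psum0E f N : psum f 0 N <= normc (f 0%N).
Proof.
case: N => [|N]; first by rewrite /psum big_ord0 normc_ge0.
rewrite /psum big_ord_recl big1 /= ?expr0 ?mulr1 ?addr0 // => i _.
by rewrite exprS mul0r mulr0.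
Qed.

Lemma abscvg0 f : abscvg f 0.
Proof. by exists (normc (f 0%N)) => N; exact: psum0E. Qed.

Lemma abscvg_le f x y : 0 <= x -> x <= y -> abscvg f y -> abscvg f x.
Proof.
by move=> x0 xy [M fM]; exists M => N; rewrite (le_trans _ (fM N)) // ler_psum.
Qed.

Lemma psum_le_asum f x N : abscvg f x -> psum f x N <= asum f x.
Proof.
move=> [M fM]; apply: ub_le_sup; last by exists N.
by exists M => _ [n _ <-].
Qed.

Lemma asum_le f x M : (forall N, psum f x N <= M) -> asum f x <= M.
Proof.
move=> fM; apply: ge_sup; last by move=> _ [n _ <-].
by exists (psum f x 0); exists 0%N.
Qed.

Lemma asum_ge0 f x : 0 <= x -> abscvg f x -> 0 <= asum f x.
Proof.
by move=> x0 fx; rewrite (le_trans (psum_ge0 f 0%N x0)) // psum_le_asum.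
Qed.

Lemma ler_asum f x y : 0 <= x -> x <= y -> abscvg f y -> asum f x <= asum f y.
Proof.
move=> x0 xy fy; apply: asum_le => N.
by rewrite (le_trans _ (psum_le_asum N fy)) // ler_psum.
Qed.

Lemma psum_cvg f x : 0 <= x -> abscvg f x -> psum f x @ \oo --> asum f x.
Proof.
move=> x0 [M fM]; apply: nondecreasing_cvgn; first exact: psum_nondecreasing.
by exists M => _ [n _ <-].
Qed.

Lemma asum_tail_cvg f x : 0 <= x -> abscvg f x ->
  (fun N => asum f x - psum f x N) @ \oo --> (0 : R).
Proof.
move=> x0 fx; rewrite -(subrr (asum f x)).
by apply: cvgB; [exact: cvg_cst|exact: psum_cvg].
Qed.

Lemma asum0 f : asum f 0 = normc (f 0%N).
Proof.
apply/eqP; rewrite eq_le asum_le /=; last exact: psum0E.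
rewrite (le_trans _ (psum_le_asum 1 (abscvg0 f))) //.
by rewrite /psum big_ord_recl big_ord0 addr0 mulr1.
Qed.

Lemma csum_dist f z N M : (N <= M)%N ->
  normc (csum f z M - csum f z N) <= psum f (normc z) M - psum f (normc z) N.
Proof.
elim: M => [|M IH]; first by rewrite leqn0 => /eqP->; rewrite !subrr normc0.
rewrite leq_eqVlt => /predU1P[->|NM]; first by rewrite !subrr normc0.
rewrite csumS psumS !(addrAC _ _ (- _)) (le_trans (normcD _ _)) //.
by rewrite lerD ?IH // normcM normcX.
Qed.

Lemma csum_norm f z N : normc (csum f z N) <= psum f (normc z) N.
Proof.
have := csum_dist f z (leq0n N).
by rewrite /csum /psum !big_ord0 !subr0.
Qed.

Lemma abscvg_cvg f z : abscvg f (normc z) -> fps_cvg f z.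
Proof.
move=> fz; rewrite /fps_cvg fps_seriesE.
(* [h] stands for the real or the imaginary part: additive and dominated by the modulus. *)
have cv (h : C -> R) : (forall w, `|h w| <= normc w) ->
    (forall a b, h (a + b) = h a + h b) -> cvgn (fun n => h (csum f z n)).
  move=> hn hD; have h0 : h 0 = 0 by apply: (addrI (h 0)); rewrite -hD !addr0.
  have -> : (fun n => h (csum f z n)) = series (fun n => h (f n * z ^+ n)).
    apply/funext; elim => [|n IH]; first by rewrite /csum /series /= big_ord0 big_geq.
    by rewrite csumS hD IH /series /= big_nat_recr.
  apply: normed_cvg => /=.
  apply: (@series_le_cvg _ _ (fun n => normc (f n) * normc z ^+ n)) => n.
  - exact: normr_ge0.
  - by rewrite psum_term_ge0 ?normc_ge0.
  - by rewrite (le_trans (hn _)) // normcM normcX.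
  have -> : series (fun n => normc (f n) * normc z ^+ n) = psum f (normc z).
    by apply/funext => k; rewrite /series /= big_mkord.
  by apply: (cvgP (asum f (normc z))); apply: psum_cvg => //; exact: normc_ge0.
apply: is_cvgC.
- by apply: cv => [w|[a b] [c d]//]; exact: normc_Re.
- by apply: cv => [w|[a b] [c d]//]; exact: normc_Im.
Qed.

Lemma csum_cvg f z : abscvg f (normc z) -> csum f z @ \oo --> fps_eval f z.
Proof. by move=> /abscvg_cvg; rewrite /fps_cvg /fps_eval fps_seriesE. Qed.

Lemma normc_cvg_le (u : K^nat) (l : K) (M : R) N : u @ \oo --> l ->
  (forall n, (N <= n)%N -> normc (u n) <= M) -> normc l <= M.
Proof.
move=> /cvgC_P ul uM.
have H : (fun n => M + normc (u n - l)) @ \oo --> M + 0.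
  by apply: cvgD => //; exact: cvg_cst.
rewrite -[M]addr0; apply: (cvgr_to_ge H).
exists N => // n /= Nn.
rewrite -{1}(subrK (u n) l) addrC (le_trans (normcD _ _)) //.
by rewrite lerD ?uM // normcB.
Qed.

Lemma eval_tail f z N : abscvg f (normc z) ->
  normc (fps_eval f z - csum f z N) <= asum f (normc z) - psum f (normc z) N.
Proof.
move=> fz; apply: (@normc_cvg_le (fun n => csum f z n - csum f z N) _ _ N).
  by apply: cvgB; [exact: csum_cvg|exact: cvg_cst].
move=> n Nn; rewrite (le_trans (csum_dist f z Nn)) //.
by rewrite lerD2r psum_le_asum.
Qed.

Lemma eval_norm f z : abscvg f (normc z) -> normc (fps_eval f z) <= asum f (normc z).
Proof.
move=> fz; have := eval_tail 0 fz.
by rewrite /csum /psum !big_ord0 !subr0.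
Qed.

Lemma eval_eq f z l : csum f z @ \oo --> l -> fps_eval f z = l.
Proof. by move=> fl; rewrite /fps_eval fps_seriesE; exact: cvgC_lim. Qed.

Lemma eval0 f : fps_eval f 0 = f 0%N.
Proof.
have -> := @eval_eq f 0 (f 0%N) _ => //.
apply/cvgC_P; apply: cvg_near_cst.
exists 1%N => // -[//|n] _ /=.
rewrite /csum big_ord_recl big1 /= ?expr0 ?mulr1 ?addr0 ?subrr ?normc0 //.
by move=> i _; rewrite exprS mul0r mulr0.
Qed.

Lemma eval_real f x : (forall n, 0 <= f n) -> 0 <= x -> abscvg f x ->
  fps_eval f x%:C = (asum f x)%:C.
Proof.
move=> f0 x0 fx; apply: eval_eq; apply/cvgC_P.
have nx : normc x%:C = x by rewrite normc_real ger0_norm.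
have E N : csum f x%:C N = (psum f x N)%:C.
  rewrite /psum rmorph_sum; apply: eq_bigr => k _.
  by rewrite rmorphM rmorphXn /= -normc_ge0_id.
under eq_fun do rewrite E -rmorphB normc_real.
have := psum_cvg x0 fx; rewrite -subr_cvg0 => /cvg_norm; rewrite normr0; exact.
Qed.

(** Comparison with the geometric series of ratio [q = x / y]. The induction bounds the partial sum
    times [1 - q] by [M * (1 - q ^+ N)], the exact value when all terms reach the bound. *)
Lemma psum_geo f x y M : 0 <= x -> x < y ->
  (forall n, normc (f n) * y ^+ n <= M) -> abscvg f x.
Proof.
move=> x0 xy fM; have y0 : 0 < y by exact: le_lt_trans xy.
have M0 : 0 <= M by rewrite (le_trans _ (fM 0%N)) // expr0 mulr1 normc_ge0.
pose q := x / y.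
have q0 : 0 <= q by rewrite divr_ge0 // ltW.
have q1 : 0 < 1 - q by rewrite subr_gt0 /q ltr_pdivrMr // mul1r.
exists (M / (1 - q)) => N; rewrite ler_pdivlMr //.
have [] : psum f x N * (1 - q) <= M * (1 - q ^+ N) /\ 0 <= q ^+ N; last first.
  move=> H qN; apply: (le_trans H); rewrite ler_piMr // lerBlDr lerDl //.
split; last exact: exprn_ge0.
elim: N => [|N IH]; first by rewrite /psum big_ord0 mul0r subrr mulr0.
rewrite psumS mulrDl.
have -> : M * (1 - q ^+ N.+1) = M * (1 - q ^+ N) + M * q ^+ N * (1 - q).
  by rewrite exprS; ring.
apply: lerD => //; rewrite ler_wpM2r ?(ltW q1) //.
have -> : normc (f N) * x ^+ N = normc (f N) * y ^+ N * q ^+ N.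
  by rewrite -mulrA -exprMn /q mulrCA divff ?mulr1 ?gt_eqF.
by rewrite ler_wpM2r ?exprn_ge0.
Qed.

(** Past some N two consecutive partial sums lie within 1 of the limit, so their difference, a term,
    is at most 2; the earlier terms are bounded by a partial sum. Bounded terms at z give absolute
    convergence strictly inside. *)
Lemma cvg_abscvg f z x : fps_cvg f z -> 0 <= x -> x < normc z -> abscvg f x.
Proof.
rewrite /fps_cvg fps_seriesE => /cvg_ex[/= l /cvgC_P fl] x0 xz.
have [N _ HN] : \forall n \near \oo, normc (csum f z n - l) < 1.
  move/cvgrPdist_lt : fl => /(_ 1 ltr01); apply: filterS => n.
  by rewrite sub0r normrN ger0_norm ?normc_ge0.
have tb n : (N <= n)%N -> normc (f n) * normc z ^+ n <= 2.
  move=> Nn; rewrite -normcX -normcM.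
  have -> : f n * z ^+ n = (csum f z n.+1 - l) - (csum f z n - l).
    by rewrite csumS; ring.
  rewrite (le_trans (normcD _ _)) // normcN.
  have := HN _ Nn; have := HN n.+1 (leqW Nn); move=> /= h1 h2.
  by rewrite (_ : 2 = 1 + 1) // lerD ?ltW.
apply: (@psum_geo f x (normc z) (2 + psum f (normc z) N)) => // n.
have [Nn|nN] := leqP N n.
  by rewrite (le_trans (tb _ Nn)) // lerDl psum_ge0 ?normc_ge0.
rewrite (@le_trans _ _ (psum f (normc z) n.+1)) //.
  by rewrite psumS lerDr psum_ge0 ?normc_ge0.
rewrite (le_trans (psum_nondecreasing f (normc_ge0 z) nN)) //.
by rewrite lerDr ler0n.
Qed.

(** With nonnegative coefficients the endpoint itself is reached: the partial sums are their own
    moduli, so convergence bounds them. *)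
Lemma cvg_abscvg_real f x : (forall n, 0 <= f n) -> 0 <= x ->
  fps_cvg f x%:C -> abscvg f x.
Proof.
rewrite /fps_cvg fps_seriesE => f0 x0 /cvg_ex[/= l /cvgC_P fl].
have [N _ HN] : \forall n \near \oo, normc (csum f x%:C n - l) < 1.
  move/cvgrPdist_lt : fl => /(_ 1 ltr01); apply: filterS => n.
  by rewrite sub0r normrN ger0_norm ?normc_ge0.
have E n : csum f x%:C n = (psum f x n)%:C.
  rewrite /psum rmorph_sum; apply: eq_bigr => k _.
  by rewrite rmorphM rmorphXn /= -normc_ge0_id.
exists (normc l + 1) => n.
rewrite (le_trans (psum_nondecreasing f x0 (leq_addl N n))) //.
rewrite -[X in X <= _]ger0_norm ?psum_ge0 // -normc_real -E.
rewrite -[csum _ _ _](subrK l) addrC (le_trans (normcD _ _)) //.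
by rewrite lerD2l ltW // HN //= leq_addr.
Qed.

End AbsoluteConvergence.

(* The last sum is the part of the product of partial sums that the partial sum
   of the Cauchy product misses. *)
Lemma cauchy_product_rest (K : comPzRingType) (a b : nat -> K) N :
  (\sum_(i < N) a i) * (\sum_(j < N) b j) =
  \sum_(n < N) \sum_(i < n.+1) a i * b (n - i)%N +
  \sum_(i < N) a i * (\sum_(j < N) b j - \sum_(j < N - i) b j).
Proof.
have -> : \sum_(n < N) \sum_(i < n.+1) a i * b (n - i)%N =
    \sum_(i < N) a i * \sum_(j < N - i) b j.
  elim: N => [|N IH]; first by rewrite !big_ord0.
  rewrite big_ord_recr /= IH [RHS]big_ord_recr /= [X in _ + X = _]big_ord_recr /=.
  rewrite addrA -big_split /= subSnn big_ord1 subnn; congr (_ + _).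
  apply: eq_bigr => i _; rewrite -mulrDr subSn ?(ltnW (ltn_ord i)) //.
  by rewrite big_ord_recr.
rewrite -big_split /= mulr_suml; apply: eq_bigr => i _.
by rewrite -mulrDr addrC subrK.
Qed.

Lemma fps_sumE (K : comNzRingType) (I : Type) (r : seq I) (P : pred I)
    (F : I -> fps K) n :
  (\sum_(i <- r | P i) F i) n = \sum_(i <- r | P i) F i n.
Proof. by elim/big_rec2: _ => [//|i x y _ <-]. Qed.

Lemma fps1_0 (K : comNzRingType) : (1 : fps K) 0%N = 1.
Proof. by []. Qed.

Lemma fps_mulE (K : comNzRingType) (f g : fps K) n :
  (f * g) n = \sum_(i < n.+1) f i * g (n - i)%N.
Proof. by []. Qed.

(** * Cauchy products: evaluation respects sums and products *)

Section AbscvgRing.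
Variable R : realType.
Local Notation C := R[i].
Local Notation K := ((R[i] : numFieldType)).
Local Open Scope complex_scope.
Local Notation normc := (@ComplexField.Normc.normc R).
Implicit Types (f g : fps C) (x y : R) (z w : C).

Lemma psumD f g x N : 0 <= x -> psum (f + g) x N <= psum f x N + psum g x N.
Proof.
move=> x0; rewrite /psum -big_split; apply: ler_sum => k _ /=.
by rewrite -mulrDl ler_wpM2r ?exprn_ge0 // normcD.
Qed.

Lemma psum_sum (I : Type) (r : seq I) (F : I -> fps C) x N : 0 <= x ->
  psum (\sum_(i <- r) F i) x N <= \sum_(i <- r) psum (F i) x N.
Proof.
move=> x0; elim/big_rec2: _ => [|i s f _ IH].
  by rewrite /psum big1 // => k _; rewrite normc0 mul0r.
by rewrite (le_trans (psumD _ _ _ x0)) // lerD2l.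
Qed.

Let mulF f g x N : psum f x N * psum g x N =
  \sum_(n < N) \sum_(i < n.+1)
     (normc (f i) * x ^+ i) * (normc (g (n - i)%N) * x ^+ (n - i)%N) +
  \sum_(i < N) (normc (f i) * x ^+ i) * (psum g x N - psum g x (N - i)).
Proof.
exact: (cauchy_product_rest (fun i => normc (f i) * x ^+ i)
  (fun i => normc (g i) * x ^+ i)).
Qed.

Let restF f g x N : R :=
  \sum_(i < N) (normc (f i) * x ^+ i) * (psum g x N - psum g x (N - i)).

Let restF_ge0 f g x N : 0 <= x -> 0 <= restF f g x N.
Proof.
move=> x0; apply: sumr_ge0 => i _; apply: mulr_ge0; first exact: psum_term_ge0.
by rewrite subr_ge0 psum_nondecreasing // leq_subr.
Qed.

Lemma psumM f g x N : 0 <= x -> psum (f * g) x N <= psum f x N * psum g x N.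
Proof.
move=> x0; rewrite mulF -/(restF f g x N).
apply: ler_wpDr; first exact: restF_ge0.
apply: ler_sum => n _; rewrite fps_mulE.
rewrite (le_trans (ler_wpM2r (exprn_ge0 n x0) (normc_sum _ _ _))) //.
rewrite mulr_suml; apply: ler_sum => i _.
by rewrite normcM mulrACA -exprD subnKC // -ltnS.
Qed.

Lemma abscvgD f g x : 0 <= x -> abscvg f x -> abscvg g x -> abscvg (f + g) x.
Proof.
move=> x0 [M fM] [M' gM]; exists (M + M') => N.
by rewrite (le_trans (psumD _ _ _ x0)) // lerD.
Qed.

Lemma abscvgN f x : abscvg f x -> abscvg (- f) x.
Proof.
move=> [M fM]; exists M => N; rewrite (le_trans _ (fM N)) //.
by apply: ler_sum => k _; rewrite normcN.
Qed.

Lemma abscvgM f g x : 0 <= x -> abscvg f x -> abscvg g x -> abscvg (f * g) x.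
Proof.
move=> x0 [M fM] [M' gM]; exists (M * M') => N.
by rewrite (le_trans (psumM _ _ _ x0)) // ler_pM ?psum_ge0.
Qed.

Lemma abscvg_0 x : abscvg 0 x.
Proof. by exists 0 => N; rewrite /psum big1 // => k _; rewrite normc0 mul0r. Qed.

Lemma abscvg_1 x : abscvg 1 x.
Proof.
exists 1 => -[|N]; first by rewrite /psum big_ord0.
rewrite /psum big_ord_recl big1 ?addr0; last first.
  by move=> i _; rewrite [(1 : fps C) _]/= normc0 mul0r.
by rewrite [(1 : fps C) _]fps1_0 normc1 expr0 mulr1.
Qed.

Lemma abscvg_sum (I : Type) (r : seq I) (P : pred I) (F : I -> fps C) x : 0 <= x ->
  (forall i, P i -> abscvg (F i) x) -> abscvg (\sum_(i <- r | P i) F i) x.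
Proof.
move=> x0 Fx; elim/big_ind: _ => //; first exact: abscvg_0.
by move=> f g; exact: abscvgD.
Qed.

Lemma abscvg_prod (I : Type) (r : seq I) (P : pred I) (F : I -> fps C) x : 0 <= x ->
  (forall i, P i -> abscvg (F i) x) -> abscvg (\prod_(i <- r | P i) F i) x.
Proof.
move=> x0 Fx; elim/big_ind: _ => //; first exact: abscvg_1.
by move=> f g; exact: abscvgM.
Qed.

Lemma abscvg_sign n x : abscvg ((-1) ^+ n) x.
Proof.
rewrite -signr_odd; case: odd; rewrite ?expr0 ?expr1; last exact: abscvg_1.
by apply: abscvgN; exact: abscvg_1.
Qed.

Lemma abscvg_det m (M : 'M[fps C]_m) x : 0 <= x ->
  (forall i j, abscvg (M i j) x) -> abscvg (\det M) x.
Proof.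
move=> x0 Mx; apply: abscvg_sum => // s _; apply: abscvgM => //.
  exact: abscvg_sign.
exact: abscvg_prod.
Qed.

Lemma evalD f g z : abscvg f (normc z) -> abscvg g (normc z) ->
  fps_eval (f + g) z = fps_eval f z + fps_eval g z.
Proof.
move=> fz gz; apply: eval_eq.
have -> : csum (f + g) z = (fun n => csum f z n + csum g z n).
  apply/funext => n; rewrite /csum -big_split; apply: eq_bigr => k _ /=.
  by rewrite mulrDl.
by apply: cvgCD; exact: csum_cvg.
Qed.

Lemma eval_0 z : fps_eval 0 z = 0 :> C.
Proof.
apply: eval_eq.
have -> : csum 0 z = (fun n => 0 : K).
  by apply/funext => n; rewrite /csum big1 // => k _; rewrite mul0r.
exact: cvgC_cst.
Qed.

Lemma eval_1 z : fps_eval 1 z = 1 :> C.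
Proof.
apply: eval_eq; apply/cvgC_P; apply: cvg_near_cst.
exists 1%N => // -[//|n] _ /=.
rewrite /csum big_ord_recl big1 ?addr0; last first.
  by move=> i _; rewrite [(1 : fps C) _]/= mul0r.
by rewrite [(1 : fps C) _]fps1_0 expr0 mulr1 subrr normc0.
Qed.

Lemma evalN f z : abscvg f (normc z) -> fps_eval (- f) z = - fps_eval f z.
Proof.
move=> fz; apply/eqP; rewrite -addr_eq0 addrC -evalD ?subrr ?eval_0 //.
exact: abscvgN.
Qed.

Lemma eval_sum (I : Type) (r : seq I) (P : pred I) (F : I -> fps C) z :
  (forall i, P i -> abscvg (F i) (normc z)) ->
  fps_eval (\sum_(i <- r | P i) F i) z = \sum_(i <- r | P i) fps_eval (F i) z.
Proof.
move=> Fz; elim: r => [|i r IH]; first by rewrite !big_nil eval_0.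
rewrite !big_cons; case: ifP => // Pi.
rewrite evalD ?IH //; first exact: Fz.
by apply: abscvg_sum => //; exact: normc_ge0.
Qed.

(** [T] is the partial sum of the Cauchy product of the moduli. The square of indices below k lies
    in the triangle of size 2k ([T2]), so for n >= 2k the rest is at most the defect of
    [psum f x k * psum g x k] from its limit. *)
Let restF_cvg f g x : 0 <= x -> abscvg f x -> abscvg g x ->
  restF f g x @ \oo --> (0 : R).
Proof.
move=> x0 fx gx; apply/cvgrPdist_lt => e e0.
pose T N := \sum_(n < N) \sum_(i < n.+1)
     (normc (f i) * x ^+ i) * (normc (g (n - i)%N) * x ^+ (n - i)%N).
have TE N : psum f x N * psum g x N = T N + restF f g x N by exact: mulF.
have Tnd : nondecreasing_seq T.
  apply/nondecreasing_seqP => n; rewrite /T big_ord_recr lerDl /=.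
  by apply: sumr_ge0 => i _; rewrite mulr_ge0 ?psum_term_ge0.
have T2 N : psum f x N * psum g x N <= T (N + N)%N.
  have E M : T M = \sum_(i < M) (normc (f i) * x ^+ i) * psum g x (M - i).
    have := TE M; rewrite /restF => /eqP; rewrite -subr_eq => /eqP <-.
    rewrite {1}/psum mulr_suml -sumrB; apply: eq_bigr => i _.
    by rewrite -mulrBr opprB addrC subrK.
  rewrite E big_split_ord /=; apply: ler_wpDr.
    by apply: sumr_ge0 => i _; rewrite mulr_ge0 ?psum_term_ge0 ?psum_ge0.
  rewrite {1}/psum mulr_suml; apply: ler_sum => i _.
  rewrite ler_wpM2l ?psum_term_ge0 // psum_nondecreasing //.
  by rewrite -addnBA ?leq_addr // ltnW.
have fgc : (fun n => asum f x * asum g x - psum f x n * psum g x n) @ \oo --> (0 : R).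
  rewrite -(subrr (asum f x * asum g x)); apply: cvgB; first exact: cvg_cst.
  by apply: cvgM; exact: psum_cvg.
have [k _ /(_ k (leqnn k)) /= Hk] : \forall n \near \oo,
    asum f x * asum g x - psum f x n * psum g x n < e.
  move/cvgrPdist_lt: fgc => /(_ _ e0); apply: filterS => n.
  by rewrite sub0r normrN => /ltr_normlW.
exists (k + k)%N => // n /= kn.
rewrite sub0r normrN ger0_norm ?restF_ge0 //.
apply: le_lt_trans Hk.
have -> : restF f g x n = psum f x n * psum g x n - T n by rewrite TE addrAC subrr add0r.
apply: lerB; first by rewrite ler_pM ?psum_ge0 ?psum_le_asum.
by rewrite (le_trans (T2 k)) // Tnd.
Qed.

(** The complex rest of [cauchy_product_rest] is dominated term by term by the rest for the moduli,
    which tends to 0. *)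
Lemma evalM f g z : abscvg f (normc z) -> abscvg g (normc z) ->
  fps_eval (f * g) z = fps_eval f z * fps_eval g z.
Proof.
move=> fz gz; apply: eval_eq.
have -> : csum (f * g) z = (fun n => csum f z n * csum g z n -
    (csum f z n * csum g z n - csum (f * g) z n)).
  by apply/funext => n; rewrite opprB addrC subrK.
rewrite -[X in _ --> X]subr0; apply: cvgCB.
  by apply: cvgCM; exact: csum_cvg.
apply: (cvgC_squeeze (e := restF f g (normc z))); last first.
  by apply: restF_cvg => //; exact: normc_ge0.
move=> n; rewrite subr0.
have -> := cauchy_product_rest (fun i => f i * z ^+ i) (fun i => g i * z ^+ i) n
  : csum f z n * csum g z n = _.
have -> : csum (f * g) z n =
    \sum_(k < n) \sum_(i < k.+1) f i * z ^+ i * (g (k - i)%N * z ^+ (k - i)%N).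
  apply: eq_bigr => k _; rewrite fps_mulE mulr_suml.
  apply: eq_bigr => i _; rewrite mulrACA -exprD subnKC //.
  by rewrite -ltnS.
rewrite addrAC subrr add0r (le_trans (normc_sum _ _ _)) //.
apply: ler_sum => i _; rewrite !normcM normcX.
rewrite ler_wpM2l ?psum_term_ge0 ?normc_ge0 //.
by apply: csum_dist; exact: leq_subr.
Qed.

End AbscvgRing.

(** * Inverses, Taylor expansions and Abel's theorem *)

Definition fps_coef0 (K : comNzRingType) (f : fps K) : K := f 0%N.

Fact fps_coef0_is_zmod_morphism (K : comNzRingType) : zmod_morphism (@fps_coef0 K).
Proof. by []. Qed.

(** The ring morphism structure carries determinants and matrix products over to constant
    coefficients. *)
Fact fps_coef0_is_monoid_morphism (K : comNzRingType) : monoid_morphism (@fps_coef0 K).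
Proof. by split => // f g; rewrite /fps_coef0 fps_mulE big_ord1. Qed.

HB.instance Definition _ (K : comNzRingType) :=
  GRing.isZmodMorphism.Build _ _ (@fps_coef0 K) (@fps_coef0_is_zmod_morphism K).
HB.instance Definition _ (K : comNzRingType) :=
  GRing.isMonoidMorphism.Build _ _ (@fps_coef0 K) (@fps_coef0_is_monoid_morphism K).

Lemma fps_exp_val (K : comNzRingType) (h : fps K) k n :
  h 0%N = 0 -> (n < k)%N -> (h ^+ k) n = 0.
Proof.
move=> h0; elim: k n => // k IH n nk; rewrite exprS fps_mulE big1 // => i _.
have [->|i0] := posnP i; first by rewrite h0 mul0r.
rewrite IH ?mulr0 //; case: i i0 => -[//|i] /= ik _.
by rewrite -ltnS (leq_trans _ nk) // ltnS subnSK // leq_subr.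
Qed.

(** Up to the factor [f 0], f is [1 - h] with h of zero constant term, and [g] is the geometric
    series of h: only the powers up to n contribute to its coefficient of index n. *)
Lemma fps_unit_coef0 (K : fieldType) (f : fps K) :
  f 0%N != 0 -> f \is a GRing.unit.
Proof.
move=> f0.
pose h : fps K := Fps (fun n => if n is 0%N then 0 else - (f n / f 0%N)).
pose g : fps K := Fps (fun n => (\sum_(k < n.+1) h ^+ k) n).
pose g' : fps K := Fps (fun n => g n / f 0%N).
have gE N i : (i <= N)%N -> g i = (\sum_(k < N.+1) h ^+ k) i.
  move=> iN; rewrite /g /= !fps_sumE -(subnKC iN) -addSn big_split_ord /=.
  rewrite [X in _ = _ + X]big1 ?addr0 // => j _.
  by rewrite fps_exp_val // leq_addr.
have g1 : g * (1 - h) = 1.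
  apply: fpsP => N.
  transitivity (((\sum_(k < N.+1) h ^+ k) * (1 - h)) N).
    rewrite !fps_mulE; apply: eq_bigr => i _; by rewrite (gE N) // -ltnS.
  have -> : (\sum_(k < N.+1) h ^+ k) * (1 - h) = 1 - h ^+ N.+1.
    by rewrite -[RHS]opprB subrX1 -mulNr opprB mulrC.
  have -> : (1 - h ^+ N.+1) N = (1 : fps K) N - (h ^+ N.+1) N by [].
  by rewrite fps_exp_val // subr0.
have : g' * f = 1.
  rewrite -g1; apply: fpsP => n; rewrite !fps_mulE; apply: eq_bigr => i _.
  rewrite /g' -mulrA; congr (_ * _).
  have -> : (1 - h) (n - i)%N = (1 : fps K) (n - i)%N - h (n - i)%N by [].
  rewrite mulrC; case: (n - i)%N => [|k] /=; first by rewrite divff // subr0.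
  by rewrite opprK add0r.
move=> g'f; apply/unitrP; exists g'; split => //.
by rewrite mulrC.
Qed.

(** Both sides run over the same pairs with n + k < N, so regrouping by powers of q is exact for
    truncated sums. It serves for a series and for the series of its moduli. *)
Lemma binomial_rearrange (K : comNzRingType) (a : nat -> K) p q N :
  \sum_(n < N) a n * (p + q) ^+ n =
  \sum_(k < N) q ^+ k * \sum_(n < N - k) a (n + k)%N *+ 'C(n + k, k) * p ^+ n.
Proof.
elim: N => [|N IH]; first by rewrite !big_ord0.
rewrite big_ord_recr /= IH [RHS]big_ord_recr /= exprDn big_ord_recr /=.
rewrite subnn expr0 mul1r binn subSnn big_ord1 expr0 mulr1 add0n binn !mulr1n.
rewrite mulrDr addrA [a N * q ^+ N]mulrC; congr (_ + _).
rewrite mulr_sumr -big_split /=; apply: eq_bigr => k _.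
rewrite subSn ?(ltnW (ltn_ord k)) // big_ord_recr /= mulrDr; congr (_ + _).
rewrite subnK ?(ltnW (ltn_ord k)) // mulrnAl !mulrnAr; congr (_ *+ _).
by ring.
Qed.

Section PowerSeries.
Variable R : realType.
Local Notation C := R[i].
Local Notation K := ((R[i] : numFieldType)).
Local Open Scope complex_scope.
Local Notation normc := (@ComplexField.Normc.normc R).
Implicit Types (f g : fps C) (x y : R) (z w : C).

Lemma psum_scale f x t N : 0 <= x -> 0 <= t <= 1 ->
  psum f (t * x) N <= normc (f 0%N) + t * psum f x N.
Proof.
move=> x0 /andP[t0 t1]; case: N => [|N].
  by rewrite /psum !big_ord0 mulr0 addr0 normc_ge0.
rewrite /psum big_ord_recl expr0 mulr1 lerD2l mulr_sumr big_ord_recl /=.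
apply: ler_wpDl; first by rewrite mulr_ge0 // psum_term_ge0.
apply: ler_sum => i _; rewrite exprMn mulrCA ler_wpM2r ?psum_term_ge0 //.
by rewrite exprS ler_piMr // exprn_ile1.
Qed.

(** The factor [t] is chosen so that the terms of f of positive index have moduli adding up to at
    most |f(0)| at [x1 = t * x]. The recurrence for the coefficients of the inverse then gives |g_n|
    x1^n <= |g_0| by induction, and half of [x1] leaves room for a geometric series. *)
Lemma abscvg_inv f g x : 0 < x -> abscvg f x -> f 0%N != 0 -> f * g = 1 ->
  exists2 y, 0 < y <= x & abscvg g y.
Proof.
move=> x0 fx f0 fg.
have f0p : 0 < normc (f 0%N) by rewrite lt_def normc_eq0 f0 normc_ge0.
have fS : normc (f 0%N) <= asum f x.
  rewrite (le_trans _ (psum_le_asum 1 fx)) //.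
  by rewrite /psum big_ord_recl big_ord0 addr0 mulr1.
have Sp : 0 < asum f x by exact: lt_le_trans fS.
pose t := normc (f 0%N) / asum f x.
have t0 : 0 < t by rewrite divr_gt0.
have t1 : t <= 1 by rewrite ler_pdivrMr // mul1r.
pose x1 := t * x.
have x10 : 0 < x1 by rewrite mulr_gt0.
have tail n : \sum_(i < n) normc (f i.+1) * x1 ^+ i.+1 <= normc (f 0%N).
  have := @psum_scale f x t n.+1 (ltW x0); rewrite (ltW t0) t1 => /(_ isT).
  rewrite /psum big_ord_recl expr0 mulr1 lerD2l => /le_trans; apply.
  rewrite (le_trans (ler_wpM2l (ltW t0) (psum_le_asum n.+1 fx))) //.
  by rewrite /t divfK // gt_eqF.
have gb n : normc (g n) * x1 ^+ n <= normc (g 0%N).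
  elim/ltn_ind: n => -[_|n IH]; first by rewrite expr0 mulr1.
  rewrite -(ler_pM2l f0p) mulrA -normcM.
  have -> : f 0%N * g n.+1 = - \sum_(i < n.+1) f i.+1 * g (n - i)%N.
    apply/eqP; rewrite -addr_eq0; apply/eqP.
    transitivity ((f * g) n.+1); last by rewrite fg.
    by rewrite fps_mulE [RHS]big_ord_recl subn0.
  rewrite normcN (le_trans (ler_wpM2r (exprn_ge0 _ (ltW x10)) (normc_sum _ _ _))) //.
  rewrite mulr_suml.
  rewrite (@le_trans _ _ (\sum_(i < n.+1) normc (f i.+1) * x1 ^+ i.+1 * normc (g 0%N))) //.
    apply: ler_sum => i _; rewrite normcM.
    have -> : x1 ^+ n.+1 = x1 ^+ i.+1 * x1 ^+ (n - i).
      by rewrite -exprD addSn subnKC // -ltnS.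
    rewrite mulrACA ler_wpM2l ?mulr_ge0 ?normc_ge0 ?exprn_ge0 ?(ltW x10) //.
    by apply: IH; rewrite ltnS leq_subr.
  by rewrite -mulr_suml ler_wpM2r ?normc_ge0.
exists (x1 / 2).
  rewrite divr_gt0 //= (@le_trans _ _ x1) ?ler_piMl ?(ltW x0) //.
  by rewrite ler_pdivrMr ?ltr0n // ler_peMr ?(ltW x10) // ler1n.
apply: (@psum_geo _ g _ x1 (normc (g 0%N))) => //; first by rewrite divr_ge0 ?(ltW x10).
by rewrite ltr_pdivrMr ?ltr0n // ltr_pMr // ltr1n.
Qed.

(** Cramer's rule: the adjugate converges where the entries do, so only the inverse of the
    determinant can shrink the disc. *)
Lemma abscvg_invmx m (G : 'M[fps C]_m) x : 0 < x ->
  (forall i j, abscvg (G i j) x) -> \det (map_mx (@fps_coef0 C) G) != 0 ->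
  G \in unitmx /\
  exists2 y, 0 < y <= x & forall i j, abscvg (invmx G i j) y.
Proof.
move=> x0 Gx; rewrite det_map_mx => dG.
have uG : \det G \is a GRing.unit by exact: fps_unit_coef0.
have dx : abscvg (\det G) x by apply: abscvg_det => //; exact: ltW.
split; first by rewrite unitmxE.
have [y /andP[y0 yx] dy] := abscvg_inv x0 dx dG (divrr uG).
exists y; first by rewrite y0.
move=> i j; rewrite /invmx unitmxE uG !mxE; apply: abscvgM; first exact: ltW.
  exact: dy.
rewrite /cofactor; apply: abscvgM; [exact: ltW|exact: abscvg_sign|].
apply: abscvg_det => [|k l]; first exact: ltW.
by rewrite !mxE; apply: abscvg_le (Gx _ _); first exact: ltW.
Qed.

(** The k-th derivative of f divided by the factorial of k. *)
Definition fps_shift f k : fps C := Fps (fun n => f (n + k)%N *+ 'C(n + k, k)).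

Lemma normc_shift f k n :
  normc (fps_shift f k n) = normc (f (n + k)%N) *+ 'C(n + k, k).
Proof.
rewrite /= -mulr_natl normcM -(rmorph_nat (real_complex R)) normc_real.
by rewrite normr_nat mulr_natl.
Qed.

Lemma psum_shift f x y N : psum f (x + y) N =
  \sum_(k < N) y ^+ k * psum (fps_shift f k) x (N - k).
Proof.
have -> := binomial_rearrange (fun k => normc (f k)) x y N : psum f (x + y) N = _.
apply: eq_bigr => k _; congr (_ * _).
by apply: eq_bigr => n _; rewrite normc_shift.
Qed.

Lemma csum_shift f z w N : csum f (z + w) N =
  \sum_(k < N) w ^+ k * csum (fps_shift f k) z (N - k).
Proof. by rewrite /csum binomial_rearrange. Qed.

(** The rectangle i < k, n < N lies inside the triangle i + n < k + N of [psum_shift]. *)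
Lemma psum_shift_le f x y N k : 0 <= x -> 0 <= y ->
  \sum_(i < k) y ^+ i * psum (fps_shift f i) x N <= psum f (x + y) (k + N).
Proof.
move=> x0 y0; rewrite psum_shift big_split_ord /=; apply: ler_wpDr.
  by apply: sumr_ge0 => i _; rewrite mulr_ge0 ?exprn_ge0 ?psum_ge0.
apply: ler_sum => i _; rewrite ler_wpM2l ?exprn_ge0 // psum_nondecreasing //.
by rewrite addnC -addnBA ?leq_addr // ltnW.
Qed.

Lemma abscvg_shift f x y k : 0 <= x -> x < y -> abscvg f y ->
  abscvg (fps_shift f k) x.
Proof.
move=> x0 xy fy; have w0 : 0 < y - x by rewrite subr_gt0.
exists (asum f y / (y - x) ^+ k) => N.
rewrite ler_pdivlMr ?exprn_gt0 // mulrC.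
have := psum_shift_le f N k.+1 x0 (ltW w0); rewrite big_ord_recr /= => H.
rewrite (le_trans _ (psum_le_asum (k.+1 + N) fy)) //.
rewrite (addrC x) subrK in H; apply: le_trans H; apply: ler_wpDl => //.
apply: sumr_ge0 => i _.
by rewrite mulr_ge0 ?exprn_ge0 ?psum_ge0 // ltW.
Qed.

Lemma asum_shift_le f x y k : 0 <= x -> 0 <= y -> abscvg f (x + y) ->
  (forall i, abscvg (fps_shift f i) x) ->
  \sum_(i < k) y ^+ i * asum (fps_shift f i) x <= asum f (x + y).
Proof.
move=> x0 y0 fxy fx.
have H : (fun N => \sum_(i < k) y ^+ i * psum (fps_shift f i) x N) @ \oo -->
    \sum_(i < k) y ^+ i * asum (fps_shift f i) x.
  elim: k => [|k IH].
    under eq_fun do rewrite big_ord0; rewrite big_ord0; exact: cvg_cst.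
  under eq_fun do rewrite big_ord_recr; rewrite big_ord_recr /=.
  apply: cvgD => //; apply: cvgM; first exact: cvg_cst.
  exact: psum_cvg.
apply: (cvgr_to_le H); apply: nearW => N.
by rewrite (le_trans (psum_shift_le _ _ _ _ _)) // psum_le_asum.
Qed.

(** The coefficients of g are the values at z of the normalized derivatives. Its partial sums and
    those of f at z + w differ by tails of these derivatives, which add up to at most a tail of f at
    |z| + |w|, where f still converges. *)
Lemma fps_taylor f z y : normc z < y -> abscvg f y ->
  exists g, forall w, normc z + normc w <= y ->
    abscvg g (normc w) /\ fps_eval g w = fps_eval f (z + w).
Proof.
move=> zy fy; have z0 := normc_ge0 z.
have sh i : abscvg (fps_shift f i) (normc z) by exact: abscvg_shift zy fy.
pose g : fps C := Fps (fun k => fps_eval (fps_shift f k) z).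
exists g => w zw; have w0 := normc_ge0 w.
have fs : abscvg f (normc z + normc w) by apply: abscvg_le zw fy; exact: addr_ge0.
have S k : \sum_(i < k) normc w ^+ i * asum (fps_shift f i) (normc z) <=
    asum f (normc z + normc w) by exact: asum_shift_le.
have gw : abscvg g (normc w).
  exists (asum f (normc z + normc w)) => N; apply: le_trans (S N).
  apply: ler_sum => i _; rewrite mulrC ler_wpM2l ?exprn_ge0 //.
  exact: eval_norm.
split; first exact: gw.
apply: eval_eq.
have fzw : abscvg f (normc (z + w)).
  by apply: abscvg_le fs; [exact: normc_ge0|exact: normcD].
have -> : csum g w = (fun k => csum f (z + w) k - (csum f (z + w) k - csum g w k)).
  by apply/funext => k; rewrite opprB addrC subrK.
rewrite -[X in _ --> X]subr0; apply: cvgCB; first exact: csum_cvg.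
apply: (cvgC_squeeze (e := fun k => asum f (normc z + normc w) -
    psum f (normc z + normc w) k)); last by apply: asum_tail_cvg => //; exact: addr_ge0.
move=> k; rewrite subr0 csum_shift /csum -sumrB psum_shift.
rewrite (@le_trans _ _ (\sum_(i < k) (normc w ^+ i * asum (fps_shift f i) (normc z) -
   normc w ^+ i * psum (fps_shift f i) (normc z) (k - i)))) //; last first.
  by rewrite sumrB lerD2r.
rewrite (le_trans (normc_sum _ _ _)) //; apply: ler_sum => i _.
rewrite [g i * _]mulrC -!mulrBr normcM normcX ler_wpM2l ?exprn_ge0 //.
by rewrite normcB; exact: eval_tail.
Qed.

Lemma psum_continuous f N : continuous (psum f ^~ N).
Proof.
move=> x; elim: N => [|N IH].
  have -> : psum f ^~ 0%N = cst 0 by apply/funext => y; rewrite /psum big_ord0.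
  exact: cst_continuous.
have -> : psum f ^~ N.+1 = (fun y => psum f y N + normc (f N) * y ^+ N).
  by apply/funext => y; rewrite psumS.
apply: cvgD => //; apply: cvgM; first exact: cvg_cst.
exact: exprn_continuous.
Qed.

Lemma eval_dist0 f x z : 0 < x -> normc z <= x -> abscvg f x ->
  normc (fps_eval f z - f 0%N) <= normc z / x * asum f x.
Proof.
move=> x0 zx fx.
have fz : abscvg f (normc z) by apply: abscvg_le zx fx; exact: normc_ge0.
have := eval_tail 1 fz; rewrite /csum /psum !big_ord1 !expr0 !mulr1.
move=> /le_trans; apply; rewrite lerBlDl; apply: asum_le => N.
have {1}-> : normc z = normc z / x * x by rewrite divfK // gt_eqF.
rewrite (le_trans (psum_scale _ _ _ _)) ?(ltW x0) //.
  by rewrite divr_ge0 ?normc_ge0 ?(ltW x0) //= ler_pdivrMr // mul1r.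
rewrite lerD2l ler_wpM2l ?psum_le_asum //.
by rewrite divr_ge0 ?normc_ge0 ?(ltW x0).
Qed.

Lemma eval_abel f z (t : R^nat) : abscvg f (normc z) ->
  (forall n, 0 <= t n <= 1) -> t @ \oo --> (1 : R) ->
  (fun n => fps_eval f ((t n)%:C * z) : K) @ \oo --> (fps_eval f z : K).
Proof.
move=> fz t01 t1; apply/cvgC_P; apply/cvgrPdist_lt => e e0.
have z0 := normc_ge0 z.
have nt n : normc ((t n)%:C * z) = t n * normc z.
  by rewrite normcM normc_real ger0_norm //; case/andP: (t01 n).
have tz0 n : 0 <= t n * normc z by rewrite mulr_ge0 //; case/andP: (t01 n).
have tz n : t n * normc z <= normc z by rewrite ler_piMl //; case/andP: (t01 n).
(* Four errors are added: the tail of f at z, counted once for each of the two sums, and the change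
   of the partial sum of moduli between t|z| and |z|, counted once for [csum] and once inside the
   tail at tz. *)
have e3 : 0 < e / 4 by rewrite divr_gt0.
have [N _ /(_ N (leqnn N)) /= HN] : \forall n \near \oo,
    asum f (normc z) - psum f (normc z) n < e / 4.
  move/cvgrPdist_lt: (asum_tail_cvg z0 fz) => /(_ _ e3); apply: filterS => n.
  by rewrite sub0r normrN => /ltr_normlW.
have pc : (fun n => psum f (t n * normc z) N) @ \oo --> psum f (normc z) N.
  have tzc : (fun n => t n * normc z) @ \oo --> normc z.
    rewrite -[X in _ --> X]mul1r; apply: cvgM => //; exact: cvg_cst.
  exact: (cvg_comp _ _ tzc (@psum_continuous f N _)).
move/cvgrPdist_lt: pc => /(_ _ e3); apply: filterS => n Hn.
rewrite sub0r normrN ger0_norm ?normc_ge0 //.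
set a := fps_eval f _; set b := fps_eval f z.
have -> : a - b = (a - csum f ((t n)%:C * z) N) +
    ((csum f ((t n)%:C * z) N - csum f z N) - (b - csum f z N)) by ring.
have fa : abscvg f (normc ((t n)%:C * z)) by rewrite nt; exact: abscvg_le fz.
have H1 := eval_tail N fa; have H2 := eval_tail N fz.
rewrite -/a in H1; rewrite -/b in H2.
have H3 : normc (csum f ((t n)%:C * z) N - csum f z N) <=
    psum f (normc z) N - psum f (t n * normc z) N.
  rewrite /csum /psum -!sumrB (le_trans (normc_sum _ _ _)) //.
  apply: ler_sum => k _; rewrite -!mulrBr normcM ler_wpM2l ?normc_ge0 //.
  rewrite normcB exprMn -[X in X - _]mul1r -mulrBl normcM normcX.
  rewrite exprMn -[X in _ <= X - _]mul1r -mulrBl ler_wpM2r ?exprn_ge0 //.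
  rewrite -rmorphXn -(rmorph1 (real_complex R)) -rmorphB normc_real ger0_norm //.
  by case/andP: (t01 n) => ? ?; rewrite subr_ge0 exprn_ile1.
have H4 : asum f (normc ((t n)%:C * z)) <= asum f (normc z).
  by rewrite nt ler_asum.
move: H1; rewrite nt in H4 * => H1.
have := normcD (a - csum f ((t n)%:C * z) N)
  ((csum f ((t n)%:C * z) N - csum f z N) - (b - csum f z N)).
have := normcD (csum f ((t n)%:C * z) N - csum f z N) (- (b - csum f z N)).
rewrite normcN => H5 H6; have := ltr_normlW Hn => Hn'.
lra.
Qed.

End PowerSeries.

(** * Radius of convergence and regular points *)

Section Radius.
Variable R : realType.
Local Notation C := R[i].
Local Open Scope complex_scope.
Local Notation normc := (@ComplexField.Normc.normc R).
Implicit Types (f g : fps C) (x y : R) (z w : C).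

Lemma radius_abscvg_gt f x : 0 <= x -> (x%:E < fps_radius f)%E ->
  exists2 y, x < y & abscvg f y.
Proof.
move=> x0 /ereal_sup_gt[_ [z fz <-]]; rewrite lte_fin => xz.
have [h1 h2] := midf_lt xz.
exists ((x + normc z) / 2) => //; apply: cvg_abscvg fz _ h2.
exact: le_trans (ltW h1).
Qed.

Lemma radius_abscvg f x : 0 <= x -> (x%:E < fps_radius f)%E -> abscvg f x.
Proof.
move=> x0 fx; have [y xy] := radius_abscvg_gt x0 fx.
by apply: abscvg_le => //; exact: ltW.
Qed.

Lemma abscvg_radius f x : 0 <= x -> abscvg f x -> (x%:E <= fps_radius f)%E.
Proof.
move=> x0 fx; have nx : normc x%:C = x by rewrite normc_real ger0_norm.
apply: ereal_sup_ubound; exists x%:C; last by rewrite nx.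
by apply: abscvg_cvg; rewrite nx.
Qed.

Lemma radius_ge0 f : (0 <= fps_radius f)%E.
Proof. by apply: abscvg_radius => //; exact: abscvg0. Qed.

(** The radius is a supremum over points of mere convergence; the hypothesis is applied at a
    midpoint, where convergence has become absolute. *)
Lemma radius_mono f g : (forall x, 0 < x -> abscvg f x -> abscvg g x) ->
  (fps_radius f <= fps_radius g)%E.
Proof.
move=> fg; apply: ge_ereal_sup => _ [z fz <-].
rewrite leNgt; apply/negP => gz; have := radius_ge0 g.
case: (fps_radius g) gz (@abscvg_radius g) => [r||] //.
rewrite lte_fin => rz H; rewrite lee_fin => r0.
have [h1 h2] := midf_lt rz.
have m0 : 0 <= (r + normc z) / 2 by exact: le_trans (ltW h1).
have gm : abscvg g ((r + normc z) / 2).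
  by apply: fg; [exact: le_lt_trans h1|exact: cvg_abscvg fz _ h2].
by have := H _ m0 gm; rewrite lee_fin leNgt h1.
Qed.

Lemma mx_radius_le p q (M : 'M[fps C]_(p, q)) i j :
  (mx_radius M <= fps_radius (M i j))%E.
Proof.
exact: le_trans (bigmin_le _ i _) (bigmin_le _ j _).
Qed.

Lemma le_mx_radius p q (M : 'M[fps C]_(p, q)) (a : \bar R) :
  (forall i j, (a <= fps_radius (M i j))%E) -> (a <= mx_radius M)%E.
Proof.
move=> aM; apply: le_bigmin; first exact: leey.
by move=> i _; apply: le_bigmin => // ; exact: leey.
Qed.

Lemma lt_mx_radius_abscvg p q (M : 'M[fps C]_(p, q)) x i j : 0 <= x ->
  (x%:E < mx_radius M)%E -> abscvg (M i j) x.
Proof.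
move=> x0 xM; apply: radius_abscvg => //.
by apply: lt_le_trans xM _; exact: mx_radius_le.
Qed.

Lemma regular_inside f z : ((normc z)%:E < fps_radius f)%E -> regular_at f z.
Proof.
move=> fz; have [y zy fy] := radius_abscvg_gt (normc_ge0 z) fz.
have [g gP] := fps_taylor zy fy.
exists g, (y - normc z); first by rewrite subr_gt0.
move=> w wz; have [] := gP (w - z); first by rewrite -lerBrDl ltW.
move=> gw ge; split; first exact: abscvg_cvg.
by rewrite ge addrC subrK.
Qed.

Lemma cvg_disc_abscvg g r : 0 < r ->
  (forall w, normc w < r -> fps_cvg g w) -> forall x, 0 <= x < r -> abscvg g x.
Proof.
move=> r0 gr x /andP[x0 xr]; have [h1 h2] := midf_lt xr.
have nx : normc ((x + r) / 2)%:C = (x + r) / 2.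
  by rewrite normc_real ger0_norm // (le_trans x0) // ltW.
apply: (@cvg_abscvg _ g ((x + r) / 2)%:C) => //; last by rewrite nx.
by apply: gr; rewrite nx.
Qed.

(** The point z is approached along its radius by the points [u n], which are z times 1 - 1/(n+1).
    Inside the disc f and g agree; f tends to its sum at z by Abel's theorem, and g to its constant
    coefficient. *)
Lemma regular_value f g z r : 0 < r -> 0 < normc z ->
  ((normc z)%:E <= fps_radius f)%E -> abscvg f (normc z) ->
  (forall w, normc (w - z) < r -> fps_cvg g (w - z) /\
     (((normc w)%:E < fps_radius f)%E -> fps_eval f w = fps_eval g (w - z))) ->
  fps_eval f z = g 0%N.
Proof.
move=> r0 z0 zf fz H.
have gr x : 0 <= x < r -> abscvg g x.
  apply: cvg_disc_abscvg => // w wr; have [] := H (w + z); rewrite addrK //.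
pose x := r / 2; have x0 : 0 < x by rewrite divr_gt0.
have gx : abscvg g x by apply: gr; rewrite ltW //= ltr_pdivrMr // ltr_pMr // ltr1n.
have [hc h01] : (@harmonic R @ \oo --> (0 : R)) /\ forall n, 0 < @harmonic R n <= 1.
  split; first exact: cvg_harmonic.
  by move=> n; rewrite /harmonic invr_gt0 ltr0n invf_le1 ?ler1n ?ltr0n.
pose t n : R := 1 - harmonic n.
have t01 n : 0 <= t n <= 1.
  by have /andP[? ?] := h01 n; rewrite subr_ge0 gerBl; apply/andP; split=> //; exact: ltW.
have tc : t @ \oo --> (1 : R).
  by rewrite -[X in _ --> X]subr0; apply: cvgB => //; exact: cvg_cst.
have A := eval_abel fz t01 tc.
pose u n : C := (t n)%:C * z.
have un n : normc (u n - z) = harmonic n * normc z.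
  rewrite /u -[X in _ - X]mul1r -mulrBl normcM -(rmorph1 (real_complex R)) -rmorphB.
  rewrite normc_real /t addrAC subrr add0r normrN gtr0_norm //.
  by case/andP: (h01 n).
have unc : (fun n => normc (u n - z)) @ \oo --> (0 : R).
  have -> : (fun n => normc (u n - z)) = (fun n => harmonic n * normc z).
    exact/funext.
  have -> : (0 : R) = 0 * normc z by rewrite mul0r.
  by apply: cvgM => //; exact: cvg_cst.
rewrite -(cvgC_lim A); apply: cvgC_lim; apply/cvgC_P.
apply: (@squeeze_cvgr _ _ _ _ (fun=> 0) (fun n => normc (u n - z) / x * asum g x)).
- move/cvgrPdist_lt: unc => /(_ _ x0); apply: filterS => n.
  rewrite sub0r normrN ger0_norm ?normc_ge0 //= => unx.
  rewrite (_ : fps_eval f _ = fps_eval g (u n - z)); last first.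
    have [] := H (u n).
      by rewrite (lt_trans unx) // ltr_pdivrMr // ltr_pMr // ltr1n.
    move=> _; apply; apply: lt_le_trans zf; rewrite lte_fin /u normcM normc_real.
    case/andP: (t01 n) => tn0 _; rewrite ger0_norm // gtr_pMl // /t.
    by rewrite ltrBlDr ltrDl; case/andP: (h01 n).
  by apply: eval_dist0 => //; exact: ltW.
- exact: cvg_cst.
- have -> : (0 : R) = 0 / x * asum g x by rewrite !mul0r.
  by apply: cvgM; [apply: cvgM => //|]; exact: cvg_cst.
Qed.

End Radius.

(** * Perron-Frobenius theory *)

Lemma continuous_sumr (R : realType) (T : topologicalType) (I : Type)
    (r : seq I) (F : I -> T -> R) :
  (forall i, continuous (F i)) -> continuous (fun x => \sum_(i <- r) F i x).
Proof.
move=> Fc x; elim: r => [|i r IH].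
  by under eq_fun do rewrite big_nil; exact: cvg_cst.
have -> : (fun y => \sum_(k <- i :: r) F k y) =
    (fun y => F i y + \sum_(k <- r) F k y) by apply/funext => y; rewrite big_cons.
by apply: cvgD => //; exact: Fc.
Qed.

Lemma ltr_sum_at (R : realType) (I : finType) (F G : I -> R) i :
  (forall k, F k <= G k) -> F i < G i -> \sum_k F k < \sum_k G k.
Proof.
move=> FG Fi; rewrite (bigD1 i) // [ltRHS](bigD1 i) //=.
by rewrite ltr_leD // ler_sum.
Qed.

Section PerronFrobenius.
Variables (R : realType) (m : nat).
Implicit Types (M : 'I_m -> 'I_m -> R) (u v w y : 'I_m -> R).

Definition lact M v (j : 'I_m) : R := \sum_i v i * M i j.
Definition ract M v (i : 'I_m) : R := \sum_j M i j * v j.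

Definition supp_rel M : rel 'I_m := [rel i j | M i j != 0].
Definition irreducible M : Prop :=
  (forall i j, 0 <= M i j) /\ (forall i j, connect (supp_rel M) i j).

Lemma lact_ract M v u : \sum_j lact M v j * u j = \sum_i v i * ract M u i.
Proof.
rewrite /lact /ract; under eq_bigr do rewrite mulr_suml.
rewrite exchange_big /=; apply: eq_bigr => i _; rewrite mulr_sumr.
by apply: eq_bigr => j _; rewrite mulrA.
Qed.

Lemma irreducible_tr M : irreducible M -> irreducible (fun i j => M j i).
Proof.
move=> [M0 Mc]; split => // i j.
have -> : connect (supp_rel (fun i j => M j i)) i j =
    connect [rel x y | supp_rel M y x] i j by [].
by rewrite connect_rev /=.
Qed.

Lemma lact_ge0 M v : (forall i j, 0 <= M i j) -> (forall i, 0 <= v i) ->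
  forall j, 0 <= lact M v j.
Proof. by move=> M0 v0 j; apply: sumr_ge0 => i _; rewrite mulr_ge0. Qed.

(** A zero of v spreads backwards along edges: if v_j = 0 and M_kj <> 0, then v_k M_kj <= a v_j
    forces v_k = 0. By strong connectivity a single zero would make v vanish. *)
Lemma subinvariant_gt0 M v a : irreducible M -> (forall i, 0 <= v i) ->
  (exists i, v i != 0) -> (forall j, lact M v j <= a * v j) -> forall i, 0 < v i.
Proof.
move=> [M0 Mc] v0 [k vk] Mv i; rewrite lt_def v0 andbT; apply: contra vk.
have /connectP[p] := Mc k i; elim: p k => [|j p IH] k /=; first by move=> _ ->.
case/andP => Mkj pp li vi; have /eqP vj := IH _ pp li vi.
have /eqP : v k * M k j = 0.
  apply/eqP; rewrite eq_le mulr_ge0 // andbT.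
  apply: le_trans (_ : lact M v j <= 0).
    by rewrite /lact (bigD1 k) //= lerDl sumr_ge0 // => l _; rewrite mulr_ge0.
  by rewrite (le_trans (Mv j)) // vj mulr0.
by rewrite mulf_eq0 (negbTE Mkj) orbF.
Qed.

(** The identity is added to M so that a coordinate once positive stays positive; an irreducible M
    alone may be periodic. *)
Let step M v j := v j + lact M v j.

Let iter_ge0 M v n : (forall i j, 0 <= M i j) -> (forall i, 0 <= v i) ->
  forall i, 0 <= iter n (step M) v i.
Proof.
by move=> M0 v0; elim: n => //= n IH i; rewrite addr_ge0 ?lact_ge0.
Qed.

Let iter_gt0_le M v n k i : (forall i j, 0 <= M i j) -> (forall i, 0 <= v i) ->
  (n <= k)%N -> 0 < iter n (step M) v i -> 0 < iter k (step M) v i.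
Proof.
move=> M0 v0 /subnK <-; elim: (k - n)%N => // d IH /IH h.
by rewrite addSn /= ltr_wpDr // lact_ge0 // => l; exact: iter_ge0.
Qed.

Let iter_gt0 M v : irreducible M -> (forall i, 0 <= v i) -> (exists i, v i != 0) ->
  exists n, forall k i, (n <= k)%N -> 0 < iter k (step M) v i.
Proof.
move=> [M0 Mc] v0 [i0 vi0].
have H j : exists n, 0 < iter n (step M) v j.
  have /connectP[p] := Mc i0 j; elim/last_ind: p j => [|p k IH] j /=.
    by move=> _ ->; exists 0%N; rewrite /= lt_def vi0 v0.
  rewrite rcons_path last_rcons => /andP[pp Mk] ->.
  have [n hn] := IH _ pp erefl; exists n.+1 => /=.
  rewrite /step ltr_wpDl //; first exact: iter_ge0.
  rewrite /lact (bigD1 (last i0 p)) //= ltr_wpDr //.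
    by apply: sumr_ge0 => l _; rewrite mulr_ge0 // iter_ge0.
  by rewrite mulr_gt0 // lt_def M0 andbT.
have [n hn] := choice H.
exists (\max_j n j)%N => k i nk; apply: iter_gt0_le (hn i) => //.
by apply: leq_trans nk; exact: leq_bigmax.
Qed.

(** [step] is linear and commutes with M, so the slack of an iterate is the iterate of the slack. *)
Let iter_lact M v (l : R) n j : lact M (iter n (step M) v) j - l * iter n (step M) v j =
  iter n (step M) (fun j => lact M v j - l * v j) j.
Proof.
elim: n j => // n IH j; rewrite !iterS.
set V := iter n (step M) v in IH *; set W := iter n (step M) _ in IH *.
rewrite [in RHS]/step -IH [X in l * X]/step.
have -> : lact M W j = lact M (lact M V) j - l * lact M V j.
  rewrite /lact mulr_sumr -sumrB; apply: eq_bigr => i _.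
  by rewrite -IH mulrBl mulrA.
have -> : lact M (step M V) j = lact M V j + lact M (lact M V) j.
  by rewrite /lact -big_split; apply: eq_bigr => i _ /=; rewrite mulrDl.
by ring.
Qed.

(** For irreducible M the largest such l is the Perron eigenvalue (Collatz-Wielandt), which is thus
    a supremum instead of a root of the characteristic polynomial. *)
Definition subeigen M (l : R) v : Prop :=
  [/\ forall i, 0 <= v i, exists i, v i != 0 & forall j, l * v j <= lact M v j].

Lemma sum_gt0 v : (forall i, 0 <= v i) -> (exists i, v i != 0) -> 0 < \sum_i v i.
Proof.
move=> v0 [i vi]; rewrite (bigD1 i) //= ltr_wpDr ?sumr_ge0 //.
by rewrite lt_def vi v0.
Qed.

Lemma subeigen_le M l v : (forall i j, 0 <= M i j) -> subeigen M l v ->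
  l <= \sum_i \sum_j M i j.
Proof.
move=> M0 [v0 vn lv]; have s0 := sum_gt0 v0 vn.
rewrite -(ler_pM2r s0) mulr_sumr (le_trans (ler_sum _ (fun j _ => lv j))) //.
rewrite /lact exchange_big mulr_suml; apply: ler_sum => i _ /=.
rewrite mulr_suml; apply: ler_sum => j _; rewrite mulrC ler_wpM2l //.
by rewrite (bigD1 i) //= lerDl sumr_ge0.
Qed.

(* If the slack of a maximal subeigenvector were nonzero, finitely many steps of
   id + M would make it positive everywhere and the eigenvalue could be raised. *)
Lemma subeigen_max_eq M l v : irreducible M -> subeigen M l v ->
  (forall l' w, subeigen M l' w -> l' <= l) -> forall j, lact M v j = l * v j.
Proof.
move=> Mi [v0 vn lv] lmax; have M0 := Mi.1.
have [//|/existsNP[j /eqP nj]] := pselect (forall j, lact M v j = l * v j).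
pose w j := lact M v j - l * v j.
have [n1 h1] := iter_gt0 Mi v0 vn.
have [n2 h2] : exists n, forall k i, (n <= k)%N -> 0 < iter k (step M) w i.
  apply: iter_gt0 => // [i|]; first by rewrite /w subr_ge0.
  by exists j; rewrite /w subr_eq0.
pose V := iter (n1 + n2) (step M) v.
have V0 i : 0 < V i by apply: h1; exact: leq_addr.
have W0 i : 0 < lact M V i - l * V i.
  by rewrite /V iter_lact; apply: h2; exact: leq_addl.
(* Raising l by [e] costs at most the slack in every coordinate. *)
pose e := \big[Num.min/1]_i ((lact M V i - l * V i) / V i).
have e0 : 0 < e by apply: lt_bigmin => // i _; rewrite divr_gt0.
have : l + e <= l.
  apply: (lmax _ V); split => [i||i]; first exact: ltW.
    by exists j; rewrite gt_eqF.
  rewrite mulrDl -lerBrDl -ler_pdivlMr //; exact: bigmin_le.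
by rewrite gerDl leNgt e0.
Qed.

Lemma exists_max_subeigen M : (0 < m)%N -> (forall i j, 0 <= M i j) ->
  exists l, exists2 v, subeigen M l v & forall l' w, subeigen M l' w -> l' <= l.
Proof.
move=> m0 M0; pose i0 := Ordinal m0.
pose L := [set l | exists v, subeigen M l v].
have L0 : L 0.
  exists (fun=> 1); split => [i||j]; first exact: ler01.
    by exists i0; exact: oner_neq0.
  by rewrite mul0r lact_ge0 // => i; exact: ler01.
have Lb : has_ubound L by exists (\sum_i \sum_j M i j) => l [v]; exact: subeigen_le.
pose l := sup L.
have lmax l' w : subeigen M l' w -> l' <= l.
  by move=> h; apply: ub_le_sup => //; exists w.
pose f (v : 'rV[R]_m) i : R := v ord0 i.
pose a (v : 'rV[R]_m) j : R := l * f v j - lact M (f v) j.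
(* Twice the sum of the positive parts of [l v - v M]: at a nonzero v >= 0 it vanishes exactly when
   v is a subeigenvector for l. *)
pose phi (v : 'rV[R]_m) : R := \sum_j (`|a v j| + a v j).
pose S := [set v : 'rV[R]_m | (forall i, v ord0 i \in `[0, 1]) /\ \sum_i v ord0 i = 1].
have fc i : continuous (f ^~ i) by move=> x; exact: coord_continuous.
have Sc : compact S.
  have -> : S = [set v : 'rV[R]_m | forall i, [set` `[0 : R, 1]] (v ord0 i)] `&`
      [set v : 'rV[R]_m | \sum_i v ord0 i = 1].
    by apply/seteqP; split=> v [/= ? ?].
  apply: compact_closedI.
    by apply: (@rV_compact R m (fun=> [set` `[0 : R, 1]])) => i; exact: segment_compact.
  apply: (@closed_comp _ _ (fun v : 'rV[R]_m => \sum_i v ord0 i) [set 1]).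
    by move=> v _; apply: continuous_sumr.
  exact: closed_eq.
have ac j : continuous (a ^~ j).
  have c1 : continuous (fun v : 'rV[R]_m => l * f v j).
    by move=> v; apply: continuousM; [exact: cst_continuous|exact: fc].
  have c2 : continuous (fun v : 'rV[R]_m => lact M (f v) j).
    apply: (@continuous_sumr R _ _ _ (fun i (v : 'rV[R]_m) => f v i * M i j)) => i v.
    by apply: continuousM; [exact: fc|exact: cst_continuous].
  by move=> v; exact: (continuousB (@c1 v) (@c2 v)).
have phic : continuous phi.
  apply: (@continuous_sumr R _ _ _ (fun j (v : 'rV[R]_m) => `|a v j| + a v j)) => j v.
  exact: (continuousD (cvg_norm (@ac j v)) (@ac j v)).
have norm w : (forall i, 0 <= w i) -> (exists i, w i != 0) ->
    S (\row_i (w i / \sum_j w j)).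
  move=> w0 wn; have s0 := sum_gt0 w0 wn; split => [i|].
    rewrite in_itv /= mxE divr_ge0 ?(ltW s0) //= ler_pdivrMr // mul1r.
    by rewrite (bigD1 i) //= lerDl sumr_ge0.
  by under eq_bigr do rewrite mxE; rewrite -mulr_suml divff ?gt_eqF.
have S0 : S !=set0.
  eexists; apply: (norm (fun=> 1)) => [i|]; first exact: ler01.
  by exists i0; exact: oner_neq0.
have [c] := EVT_min_rV S0 Sc (continuous_subspaceT phic).
rewrite inE => -[c01 c1] cmin.
have phi0 : phi c <= 0.
  apply/ler_addgt0Pl => e e0; rewrite addr0.
  (* A subeigenvector for l', scaled into the simplex, has [phi] at most 2 (l - l'), whence the
     margin e / 2. *)
  have [l' [w [w0 wn lw]] ll'] : exists2 l', L l' & l - e / 2 < l'.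
    by apply: sup_adherent; [rewrite divr_gt0|split => //; exists 0].
  have := cmin _ (mem_set (norm w w0 wn)); move=> /le_trans; apply.
  have s0 := sum_gt0 w0 wn; set s := \sum_j w j in s0 *.
  rewrite (@le_trans _ _ (\sum_j (2 * ((l - l') * (w j / s))))) //; last first.
    rewrite -2!mulr_sumr -mulr_suml divff ?gt_eqF // mulr1.
    by lra.
  apply: ler_sum => j _.
  have aj : a (\row_i (w i / s)) j <= (l - l') * (w j / s).
    rewrite /a /f mxE mulrBl lerD2l lerN2.
    have -> : lact M (fun i => (\row_i (w i / s)) ord0 i) j = lact M w j / s.
      by rewrite /lact mulr_suml; apply: eq_bigr => i _; rewrite mxE mulrAC.
    by rewrite mulrA ler_pM2r ?invr_gt0.
  have b0 : 0 <= (l - l') * (w j / s).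
    rewrite mulr_ge0 ?divr_ge0 ?(ltW s0) // subr_ge0; apply: (lmax _ w).
    by split.
  case: ger0P => _; lra.
exists l, (f c) => //; split => [i||j].
- by have := c01 i; rewrite in_itv /= => /andP[].
- apply/not_existsP => c0; move: c1; rewrite big1 => [/esym/eqP|i _].
    by rewrite oner_eq0.
  by apply/eqP; rewrite -[_ == _]negbK; apply/negP; exact: c0.
have t0 k : 0 <= `|a c k| + a c k by rewrite addrC -lerBlDr sub0r lerNnormlW.
have : `|a c j| + a c j <= 0.
  by apply: le_trans phi0; rewrite /phi (bigD1 j) //= lerDl sumr_ge0.
rewrite -[l * _ <= _]subr_le0 -/(a c j).
by have := normr_ge0 (a c j); lra.
Qed.

Lemma perron_left M : (0 < m)%N -> irreducible M ->
  exists l, exists2 v, (forall i, 0 < v i) & forall j, lact M v j = l * v j.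
Proof.
move=> m0 Mi; have [l [v vl lmax]] := exists_max_subeigen m0 Mi.1.
have E := subeigen_max_eq Mi vl lmax.
exists l, v => //; case: vl => v0 vn _.
by apply: (@subinvariant_gt0 M v l) => // j; rewrite E.
Qed.

Definition perron_pair M (l : R) v u : Prop :=
  [/\ forall i, 0 < v i, forall i, 0 < u i,
      forall j, lact M v j = l * v j & forall i, ract M u i = l * u i].

(** A left eigenvector of the transpose is a right eigenvector of M, a priori for another eigenvalue
    k. Computing v M u in both ways gives l (v u) = k (v u), and v u > 0. *)
Lemma perron M : (0 < m)%N -> irreducible M -> exists l v u, perron_pair M l v u.
Proof.
move=> m0 Mi; have [l [v v0 vE]] := perron_left m0 Mi.
have [k [u u0 uE]] := perron_left m0 (irreducible_tr Mi).
have rE i : ract M u i = k * u i.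
  by rewrite -uE; apply: eq_bigr => j _; rewrite mulrC.
exists l, v, u; split => // i; rewrite rE; congr (_ * _).
have s0 : 0 < \sum_i v i * u i.
  by apply: sum_gt0 => [j|]; [rewrite ltW // mulr_gt0|exists i; rewrite gt_eqF // mulr_gt0].
apply: (@mulIf _ (\sum_i v i * u i)); first by rewrite gt_eqF.
have := lact_ract M v u.
under eq_bigr do rewrite vE -mulrA.
under [in RHS]eq_bigr do rewrite rE mulrCA.
by rewrite -!mulr_sumr.
Qed.

(** Pairing y with the positive right eigenvector: a (y u) <= y M u = l (y u), and y u > 0. *)
Lemma perron_subeigen M l v u a y : perron_pair M l v u -> subeigen M a y -> a <= l.
Proof.
move=> [v0 u0 vE uE] [y0 [k yk] ay].
have s0 : 0 < \sum_i y i * u i.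
  apply: sum_gt0 => [i|]; first by rewrite mulr_ge0 // ltW.
  by exists k; rewrite mulf_neq0 // gt_eqF.
rewrite -(ler_pM2r s0).
apply: le_trans (_ : \sum_j lact M y j * u j <= _).
  by rewrite mulr_sumr; apply: ler_sum => i _; rewrite mulrA ler_wpM2r // ltW.
rewrite lact_ract mulr_sumr; apply: ler_sum => i _.
by rewrite uE mulrCA.
Qed.

(** Pairing the left eigenvector of M with the right eigenvector of N: l (v u') = v M u' < v N u' =
    k (v u'). *)
Lemma perron_lt M N l v u k v' u' : perron_pair M l v u -> perron_pair N k v' u' ->
  (forall i j, M i j <= N i j) -> (exists i j, M i j < N i j) -> l < k.
Proof.
move=> [v0 u0 vE uE] [v0' u0' vE' uE'] MN [i [j Mij]].
have s0 : 0 < \sum_i v i * u' i.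
  apply: sum_gt0 => [h|]; first by rewrite mulr_ge0 // ltW.
  by exists i; rewrite mulf_neq0 // gt_eqF.
rewrite -(ltr_pM2r s0) !mulr_sumr.
under eq_bigr do rewrite mulrA -vE.
under [ltRHS]eq_bigr do rewrite mulrCA -uE'.
rewrite lact_ract; apply: (@ltr_sum_at _ _ _ _ i) => [h|].
  apply: ler_wpM2l; [exact: ltW|apply: ler_sum => n _; rewrite ler_wpM2r //].
  exact: ltW.
rewrite ltr_pM2l // /ract; apply: (@ltr_sum_at _ _ _ _ j) => [n|].
  by rewrite ler_wpM2r // ltW.
by rewrite ltr_pM2r.
Qed.

End PerronFrobenius.

(** * Periods and roots of unity *)

Section Periods.

(** Unless S is contained in {0}, [d] is the least positive number divisible by all common divisors
    of S; any nonzero element of S is such a number. For s in S, gcd(d, s) has the same property, so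
    minimality gives gcd(d, s) = d. *)
Lemma gcd_setP (S : set nat) :
  (forall s, S s -> (gcd_set S %| s)%N) /\
  (forall e, (forall s, S s -> (e %| s)%N) -> (e %| gcd_set S)%N).
Proof.
apply: (@getPex _ [set d | (forall s, S s -> (d %| s)%N) /\
               (forall e, (forall s, S s -> (e %| s)%N) -> (e %| d)%N)]).
have [S0|/existsNP[s0 /not_implyP[Ss0 s00]]] := pselect (forall s, S s -> s = 0%N).
  by exists 0%N; split => [s /S0->//|e _]; exact: dvdn0.
pose Q d := `[< (0 < d)%N /\ forall e, (forall s, S s -> (e %| s)%N) -> (e %| d)%N >].
have exQ : exists d, Q d.
  by exists s0; apply/asboolP; split => [|e]; [rewrite lt0n; exact/eqP|exact].
have [d /asboolP[d0 dP] dmin] := ex_minnP exQ.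
exists d; split => // s Ss; apply/gcdn_idPl; apply/eqP; rewrite eqn_leq.
rewrite dvdn_leq ?dvdn_gcdl //=; apply: dmin; apply/asboolP; split.
  by rewrite gcdn_gt0 d0.
by move=> e eS; rewrite dvdn_gcd dP //= eS.
Qed.

Variable K : nzRingType.
Implicit Types f : fps K.

Lemma fps_valP f n : f n != 0 ->
  f (fps_val f) != 0 /\ forall k, f k != 0 -> (fps_val f <= k)%N.
Proof.
move=> fn; apply: (@getPex _ [set v | fps_supp f v /\
  forall n, fps_supp f n -> (v <= n)%N]).
have ex : exists n, f n != 0 by exists n.
by have [v fv vmin] := ex_minnP ex; exists v.
Qed.

Lemma period_dvd f n : f n != 0 -> (fps_period f %| n - fps_val f)%N.
Proof. by move=> fn; apply: (gcd_setP _).1; exists n. Qed.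

Lemma expr_gcdn (L : unitRingType) (w : L) a b : w ^+ a = 1 -> w ^+ b = 1 ->
  w ^+ gcdn a b = 1.
Proof.
move=> wa wb; have [->|a0] := posnP a; first by rewrite gcd0n.
case: (egcdnP b a0) => u v E _.
have : w ^+ (u * a) = 1 by rewrite mulnC exprM wa expr1n.
by rewrite E exprD [(v * b)%N]mulnC exprM wb expr1n mul1r.
Qed.

(** S may be infinite, so the gcd is not reached by iterating [expr_gcdn]. If w has finite order,
    the order divides every element of S, hence the gcd; otherwise S contains at most 0 and the gcd
    is 0. *)
Lemma expr_gcd_set (L : unitRingType) (w : L) (S : set nat) :
  (forall s, S s -> w ^+ s = 1) -> w ^+ gcd_set S = 1.
Proof.
move=> wS; have [dS dmax] := gcd_setP S.
have [[p p0 wp]|no] := pselect (exists2 p, (0 < p)%N & w ^+ p = 1).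
  have ex : exists p, (0 < p)%N && (w ^+ p == 1) by exists p; rewrite p0 wp eqxx.
  have [d /andP[d0 /eqP wd] dmin] := ex_minnP ex.
  suff /dvdnP[k ->] : (d %| gcd_set S)%N by rewrite mulnC exprM wd expr1n.
  apply: dmax => s Ss; apply/gcdn_idPl; apply/eqP; rewrite eqn_leq.
  rewrite dvdn_leq ?dvdn_gcdl //= dmin // gcdn_gt0 d0 /=.
  by rewrite expr_gcdn // wS.
suff : (0 %| gcd_set S)%N by rewrite dvd0n => /eqP ->; rewrite expr0.
apply: dmax => s Ss; rewrite dvd0n; apply/eqP; case: (posnP s) => // s0.
by case: no; exists s => //; exact: wS.
Qed.

Lemma expr_period (L : unitRingType) (w : L) f : w \is a GRing.unit ->
  (forall n k, f n != 0 -> f k != 0 -> w ^+ n = w ^+ k) -> w ^+ fps_period f = 1.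
Proof.
move=> wu wf; apply: expr_gcd_set => _ [n /= fn <-].
have [fv vmin] := fps_valP fn.
apply: (@mulIr _ (w ^+ fps_val f)); first exact: unitrX.
by rewrite -exprD subnK ?vmin // mul1r; exact: wf.
Qed.

Lemma expr_big_gcdn (L : unitRingType) (w : L) (I : Type) (r : seq I) (P : pred I)
    (F : I -> nat) : (forall i, P i -> w ^+ F i = 1) ->
  w ^+ (\big[gcdn/0%N]_(i <- r | P i) F i) = 1.
Proof.
by move=> wF; elim/big_ind: _ => // a b; exact: expr_gcdn.
Qed.

Lemma big_gcdn_dvd (I : finType) (F : I -> nat) i :
  (\big[gcdn/0%N]_i F i %| F i)%N.
Proof. by rewrite (bigD1 i) //= dvdn_gcdl. Qed.

End Periods.

Section UnitCircle.
Variable R : realType.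
Local Notation C := R[i].
Local Open Scope complex_scope.

Lemma expiD (a b : R) : expi (a + b) = expi a * expi b.
Proof.
rewrite /expi cosD sinD; simpc; congr (_ +i* _).
by rewrite addrC [cos a * _]mulrC.
Qed.

Lemma expi0 : expi (0 : R) = 1.
Proof. by rewrite /expi cos0 sin0. Qed.

Lemma expiX (a : R) k : expi a ^+ k = expi (a * k%:R).
Proof.
elim: k => [|k IH]; first by rewrite mulr0 expi0 expr0.
by rewrite exprS IH -expiD -natr1 mulrDr mulr1 addrC.
Qed.

Lemma expi_2pi : expi (2 * pi) = 1 :> C.
Proof.
have -> : 2 * pi = pi + pi :> R by ring.
by rewrite expiD /expi cospi sinpi; simpc.
Qed.

Lemma expi_neq1 (a : R) : 0 < a < 2 * pi -> expi a != 1.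
Proof.
move=> /andP[a0 a2]; apply/eqP => -[ca _].
have s0 : 0 < sin (a / 2).
  apply: sin_gt0_pi; rewrite divr_gt0 //= ltr_pdivrMr // mulrC //.
have : cos (a / 2 + a / 2) = 1 by rewrite -splitr.
rewrite cosD; have := cos2Dsin2 (a / 2) => h1 h2.
have : sin (a / 2) ^+ 2 = 0 by rewrite expr2; rewrite !expr2 in h1; lra.
by move/eqP; rewrite sqrf_eq0 gt_eqF.
Qed.

Lemma root_of_unity_expi (w : C) q : (0 < q)%N -> w ^+ q = 1 ->
  exists2 k, (k < q)%N & w = expi (2 * pi * k%:R / q%:R).
Proof.
move=> q0 wq; pose z : C := expi (2 * pi / q%:R).
have q0' : (0 : R) < q%:R by rewrite ltr0n.
have zE k : z ^+ k = expi (2 * pi * k%:R / q%:R).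
  by rewrite /z expiX mulrAC.
have pz : q.-primitive_root z.
  rewrite /primitive_root_of_unity q0 /=; apply/forallP => -[i iq] /=.
  rewrite unity_rootE zE; have [->|nq] := eqVneq i.+1 q.
    have -> : 2 * pi * q%:R / q%:R = 2 * pi :> R by rewrite mulfK // gt_eqF.
    by rewrite expi_2pi eqxx.
  rewrite (negbTE (expi_neq1 _)) // divr_gt0 ?mulr_gt0 ?pi_gt0 //=.
  rewrite ltr_pdivrMr // ltr_pM2l ?mulr_gt0 ?pi_gt0 // ltr_nat.
  by rewrite ltn_neqAle nq iq.
by have [i ->] := prim_rootP pz wq; exists i => //; rewrite zE.
Qed.

End UnitCircle.

(** * Nonnegative systems and the critical point *)

Section NonnegativeSolutions.
Variables (K : numFieldType) (m p : nat).
Implicit Types (M : 'M[K]_m) (A Y : 'M[fps K]_(m, p)) (B : 'M[fps K]_m).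

(** Iterating the equation shows that y - M^k y is the sum of the M^h c with h < k, which is
    nonnegative, and M^k vanishes for some k. *)
Lemma nilpotent_solution_ge0 M (c y : 'M[K]_(m, p)) : (forall i j, 0 <= M i j) ->
  is_nilpotent M -> (forall i j, 0 <= c i j) -> y = c + M *m y ->
  forall i j, 0 <= y i j.
Proof.
move=> M0 [k Mk] c0 yE i j.
suff /(_ k i j) : forall k i j, 0 <= (y - (M ^+ k) *m y) i j.
  by rewrite Mk mul0mx subr0.
elim=> [|{Mk}k IH] {}i {}j; first by rewrite expr0 mul1mx subrr mxE.
have -> : y - (M ^+ k.+1) *m y = c + M *m (y - (M ^+ k) *m y).
  by rewrite exprS -[M * _]/(M *m _) mulmxBr mulmxA addrA -yE.
rewrite !mxE addr_ge0 // sumr_ge0 // => l _.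
by rewrite mulr_ge0.
Qed.

Lemma solution_coefE A B Y : Y = A + B *m Y -> forall i j n,
  Y i j n = A i j n + \sum_l \sum_(a < n.+1) B i l a * Y l j (n - a)%N.
Proof.
move=> YE i j n; rewrite {1}YE !mxE.
rewrite [LHS]/= fps_sumE; congr (_ + _).
Qed.

Section Positive.
Variables (A Y : 'M[fps K]_(m, p)) (B : 'M[fps K]_m).
Hypotheses (A0 : forall i j n, 0 <= A i j n) (B0 : forall i j n, 0 <= B i j n).
Hypotheses (Bnil : is_nilpotent (map_mx (@fps_coef0 K) B)) (YE : Y = A + B *m Y).

(** Induction on n: the coefficients of index n solve an equation y = c + B(0) y, where c is built
    from A, B and the coefficients of Y of smaller index. *)
Lemma solution_ge0 i j n : 0 <= Y i j n.
Proof.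
elim/ltn_ind: n i j => n IH i j.
pose y := \matrix_(i, j) Y i j n.
have -> : Y i j n = y i j by rewrite mxE.
apply: (@nilpotent_solution_ge0 (map_mx (@fps_coef0 K) B)
  (\matrix_(i, j) (A i j n + \sum_l \sum_(a < n) B i l a.+1 * Y l j (n - a.+1)%N))).
- by move=> k l; rewrite mxE; exact: B0.
- exact: Bnil.
- move=> k l; rewrite mxE addr_ge0 // sumr_ge0 // => h _; rewrite sumr_ge0 // => a _.
  rewrite mulr_ge0 // IH // ltn_subrL /=.
  by rewrite (leq_trans _ (ltn_ord a)).
apply/matrixP => k l; rewrite !mxE (solution_coefE YE) -addrA; congr (_ + _).
rewrite -big_split /=; apply: eq_bigr => h _.
by rewrite big_ord_recl subn0 !mxE addrC.
Qed.

Lemma solution_geA i j n : A i j n <= Y i j n.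
Proof.
rewrite (solution_coefE YE) lerDl sumr_ge0 // => l _; rewrite sumr_ge0 // => a _.
by rewrite mulr_ge0 // solution_ge0.
Qed.

Lemma solution_geB i l j a b : B i l a * Y l j b <= Y i j (a + b)%N.
Proof.
have ab : (a < (a + b).+1)%N by rewrite ltnS leq_addr.
apply: le_trans (_ : \sum_(c < (a + b).+1) B i l c * Y l j (a + b - c)%N <= _).
  rewrite (bigD1 (Ordinal ab)) //= addKn lerDl sumr_ge0 // => c _.
  by rewrite mulr_ge0 // solution_ge0.
rewrite (solution_coefE YE) (bigD1 l) //= addrCA lerDl addr_ge0 //.
apply: sumr_ge0 => h _; apply: sumr_ge0 => k _.
by rewrite mulr_ge0 // solution_ge0.
Qed.

End Positive.
End NonnegativeSolutions.

Lemma lt_EFin_dense (R : realType) (x : R) (e : \bar R) : (x%:E < e)%E ->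
  exists2 y, x < y & (y%:E < e)%E.
Proof.
case: e => [r||] //.
- by rewrite lte_fin => /midf_lt[h1 h2]; exists ((x + r) / 2).
- by move=> _; exists (x + 1); rewrite ?ltrDl // ltry.
Qed.

Section AsumOrder.
Variable R : realType.
Local Notation C := R[i].
Local Open Scope complex_scope.
Local Notation normc := (@ComplexField.Normc.normc R).
Implicit Types (f g : fps C) (x y : R).

Lemma term_le_psum f x n N : 0 <= x -> (n < N)%N ->
  normc (f n) * x ^+ n <= psum f x N.
Proof.
move=> x0 nN; rewrite (le_trans _ (psum_nondecreasing f x0 nN)) //.
by rewrite psumS lerDr psum_ge0.
Qed.

Lemma term_le_asum f x n : 0 <= x -> abscvg f x ->
  normc (f n) * x ^+ n <= asum f x.
Proof.
by move=> x0 fx; apply: le_trans (psum_le_asum n.+1 fx); exact: term_le_psum.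
Qed.

Lemma normc_gt0 (z : C) : (0 < normc z) = (z != 0).
Proof. by rewrite lt_def normc_eq0 normc_ge0 andbT. Qed.

Lemma asum_gt0 f x n : 0 < x -> abscvg f x -> f n != 0 -> 0 < asum f x.
Proof.
move=> x0 fx fn; apply: lt_le_trans (term_le_asum n (ltW x0) fx).
by rewrite mulr_gt0 ?normc_gt0 ?exprn_gt0.
Qed.

Lemma asum_lt f x y n : 0 <= x -> x < y -> abscvg f y -> (0 < n)%N -> f n != 0 ->
  asum f x < asum f y.
Proof.
move=> x0 xy fy n0 fn; have y0 : 0 <= y by rewrite (le_trans x0) // ltW.
pose d := normc (f n) * (y ^+ n - x ^+ n).
have d0 : 0 < d.
  by rewrite mulr_gt0 ?normc_gt0 // subr_gt0 ltrXn2r // -?lt0n // ?nnegrE.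
suff : asum f x <= asum f y - d by move/le_lt_trans; apply; rewrite ltrBlDr ltrDl.
apply: asum_le => N; rewrite lerBrDr.
apply: le_trans (psum_le_asum (N + n.+1) fy).
apply: le_trans (_ : psum f x (N + n.+1) + d <= _).
  by rewrite lerD2r psum_nondecreasing // leq_addr.
rewrite addrC -lerBrDr /psum -sumrB.
have nN : (n < N + n.+1)%N by rewrite addnS ltnS leq_addl.
rewrite (bigD1 (Ordinal nN)) //= -mulrBr lerDl sumr_ge0 // => k _.
by rewrite subr_ge0 ler_wpM2l ?normc_ge0 // lerXn2r ?nnegrE // ltW.
Qed.

Lemma expr_convex (a b t : R) n : 0 <= a -> a <= b -> 0 <= t <= 1 ->
  ((1 - t) * a + t * b) ^+ n <= (1 - t) * a ^+ n + t * b ^+ n.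
Proof.
move=> a0 ab /andP[t0 t1]; have b0 : 0 <= b by exact: le_trans ab.
elim: n => [|n IH]; first by rewrite !expr0; lra.
have c0 : 0 <= (1 - t) * a + t * b by rewrite addr_ge0 ?mulr_ge0 ?subr_ge0.
rewrite exprS (le_trans (ler_wpM2l c0 IH)) // -subr_ge0 !exprS.
have -> : (1 - t) * (a * a ^+ n) + t * (b * b ^+ n) -
  ((1 - t) * a + t * b) * ((1 - t) * a ^+ n + t * b ^+ n) =
  t * (1 - t) * ((b - a) * (b ^+ n - a ^+ n)) by ring.
by rewrite !mulr_ge0 ?subr_ge0 // lerXn2r ?nnegrE.
Qed.

Lemma asum_convex f (a b t : R) : 0 <= a -> a <= b -> 0 <= t <= 1 ->
  abscvg f b -> asum f ((1 - t) * a + t * b) <= (1 - t) * asum f a + t * asum f b.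
Proof.
move=> a0 ab t01 fb; have /andP[t0 t1] := t01.
have fa : abscvg f a by exact: abscvg_le fb.
apply: asum_le => N; apply: le_trans (_ : (1 - t) * psum f a N + t * psum f b N <= _).
  rewrite /psum !mulr_sumr -big_split; apply: ler_sum => k _ /=.
  rewrite !(mulrCA _ (normc _)) -mulrDr ler_wpM2l ?normc_ge0 //.
  exact: expr_convex.
by rewrite lerD // ler_wpM2l ?subr_ge0 ?psum_le_asum.
Qed.

Lemma radius_ge f (e : \bar R) :
  (forall x, 0 < x -> (x%:E < e)%E -> abscvg f x) -> (e <= fps_radius f)%E.
Proof.
move=> H; rewrite leNgt; apply/negP => fe; have := radius_ge0 f.
case: (fps_radius f) fe (@abscvg_radius R f) => [r|+ _ _|_ _ //]; last first.
  by rewrite ltNge leey.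
move=> re Hr; rewrite lee_fin => r0.
have [y ry ye] := lt_EFin_dense re; have y0 := le_lt_trans r0 ry.
by have := Hr y (ltW y0) (H y y0 ye); rewrite lee_fin leNgt ry.
Qed.

End AsumOrder.

Lemma largest_real_eigenvalue_unique (R : realType) n (M : 'M[R[i]]_n) (l k : R) :
  largest_real_eigenvalue M l -> largest_real_eigenvalue M k -> l = k.
Proof.
by move=> [l1 l2] [k1 k2]; apply/eqP; rewrite eq_le l2 // k2.
Qed.

(** The absolute values of a left eigenvector for k form a subeigenvector for |k|, whence |k| <= l.
    The eigenvector can be taken real because the matrix and the eigenvalue are. *)
Lemma perron_largest (R : realType) m (M : 'I_m -> 'I_m -> R) l v u : (0 < m)%N ->
  (forall i j, 0 <= M i j) -> perron_pair M l v u ->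
  largest_real_eigenvalue (map_mx (real_complex R) (\matrix_(i, j) M i j)) l.
Proof.
move=> m0 M0 pp; have [v0 u0 vE uE] := pp; split.
  rewrite eigenvalue_map; apply/eigenvalueP; exists (\row_i v i).
    apply/rowP => j; rewrite !mxE -vE; apply: eq_bigr => i _; by rewrite !mxE.
  apply/eqP => /rowP/(_ (Ordinal m0)); rewrite !mxE => /eqP.
  by rewrite gt_eqF.
move=> k; rewrite eigenvalue_map => /eigenvalueP[y yE yn].
rewrite (le_trans (ler_norm k)) //.
apply: (@perron_subeigen _ _ M l v u _ (fun i => `|y ord0 i|)) => //; split => [//||j].
  by have /rV0Pn[i yi] := yn; exists i; rewrite normr_eq0.
rewrite -normrM; have := congr1 (fun w : 'rV_m => w ord0 j) yE; rewrite !mxE => <-.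
rewrite (le_trans (ler_norm_sum _ _ _)) //; apply: ler_sum => i _.
by rewrite normrM mxE [X in _ * X]ger0_norm.
Qed.

Lemma cvg_sumr (R : realType) (T I : Type) (F : set_system T) {FF : Filter F}
    (r : seq I) (f : I -> T -> R) (a : I -> R) :
  (forall i, f i @ F --> a i) ->
  (fun x => \sum_(i <- r) f i x) @ F --> \sum_(i <- r) a i.
Proof.
move=> fa; elim: r => [|i r IH].
  have -> : (fun x => \sum_(i <- [::]) f i x) = cst 0.
    by apply/funext => x; rewrite big_nil.
  by rewrite big_nil; exact: cvg_cst.
have -> : (fun x => \sum_(k <- i :: r) f k x) =
    (fun x => f i x + \sum_(k <- r) f k x) by apply/funext => x; rewrite big_cons.
by rewrite big_cons; apply: cvgD.
Qed.

(** * The matrix B(x) for real x and the critical point *)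

Section CriticalPoint.
Variables (R : realType) (m : nat) (B : 'M[fps R[i]]_m).
Local Notation C := R[i].
Local Open Scope complex_scope.
Local Notation normc := (@ComplexField.Normc.normc R).

Hypothesis B_ge0 : forall i j n, 0 <= B i j n.
Hypothesis B0_nil : is_nilpotent (map_mx (@fps_coef0 C) B).
Hypothesis B_rec : ~ is_nilpotent B.
Hypothesis B_conn : forall i j, connect (dependency B) i j.

Definition asum_mx (x : R) (i j : 'I_m) : R := asum (B i j) x.
Definition mx_abscvg (x : R) : Prop := forall i j, abscvg (B i j) x.

Lemma recursive_dim : (0 < m)%N.
Proof.
rewrite lt0n; apply/eqP => m0; apply: B_rec; exists 0%N.
by apply/matrixP => -[i im]; exfalso; move: im; rewrite m0.
Qed.

Lemma fps_neq0P (f : fps C) : f != 0 -> exists n, f n != 0.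
Proof.
move=> f0; apply/not_existsP => fn; move/eqP: f0; apply; apply: fpsP => n.
by apply/eqP; rewrite -[_ == _]negbK; apply/negP; exact: fn.
Qed.

(** If every entry were constant, the powers of B would be those of B(0), and B would be
    nilpotent. *)
Lemma nonconstant_entry : exists i j n, (0 < n)%N /\ B i j n != 0.
Proof.
apply: contrapT => H; apply: B_rec; have [k Bk] := B0_nil; exists k.
have B0 i j n : (0 < n)%N -> B i j n = 0.
  move=> n0; apply: contrapT => Bn; apply: H; exists i, j, n; split => //.
  exact/eqP.
suff E l i j n : (B ^+ l) i j n =
    if n is 0%N then (map_mx (@fps_coef0 C) B ^+ l) i j else 0.
  apply/matrixP => i j; apply: fpsP => n; rewrite E Bk !mxE.
  by case: n.
elim: l i j n => [|l IH] i j n.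
  by rewrite !expr0 !mxE; case: n => [|n]; case: (i == j).
rewrite !exprS -[B * _]/(B *m _) -[map_mx _ _ * _]/(map_mx _ _ *m _) !mxE fps_sumE.
have -> : \sum_k0 (B i k0 * (B ^+ l) k0 j) n = \sum_k0 B i k0 0%N * (B ^+ l) k0 j n.
  apply: eq_bigr => h _; rewrite fps_mulE big_ord_recl subn0 big1 ?addr0 // => a _.
  by rewrite B0 ?mul0r.
case: n => [|n]; first by apply: eq_bigr => h _; rewrite IH !mxE.
by rewrite big1 // => h _; rewrite IH mulr0.
Qed.

Lemma mx_cvgP x : 0 <= x -> mx_cvg B x%:C <-> mx_abscvg x.
Proof.
move=> x0; split => Bx i j; first exact: cvg_abscvg_real.
by apply: abscvg_cvg; rewrite normc_real ger0_norm.
Qed.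

Lemma mx_eval_real x : 0 <= x -> mx_abscvg x ->
  mx_eval B x%:C = map_mx (real_complex R) (\matrix_(i, j) asum_mx x i j).
Proof.
by move=> x0 Bx; apply/matrixP => i j; rewrite !mxE eval_real.
Qed.

Lemma mx_abscvg_le x y : 0 <= x -> x <= y -> mx_abscvg y -> mx_abscvg x.
Proof. by move=> x0 xy By i j; exact: abscvg_le (By i j). Qed.

Lemma asum_mx_ge0 x : 0 <= x -> mx_abscvg x -> forall i j, 0 <= asum_mx x i j.
Proof. by move=> x0 Bx i j; exact: asum_ge0. Qed.

Lemma ler_asum_mx x y : 0 <= x -> x <= y -> mx_abscvg y ->
  forall i j, asum_mx x i j <= asum_mx y i j.
Proof. by move=> x0 xy By i j; exact: ler_asum. Qed.

Lemma asum_mx_irreducible x : 0 < x -> mx_abscvg x -> irreducible (asum_mx x).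
Proof.
move=> x0 Bx; split; first by apply: asum_mx_ge0 => //; exact: ltW.
move=> i j; apply: (@connect_sub _ (dependency B)); last exact: B_conn.
move=> k l /= Bkl; apply: connect1 => /=.
have [n Bn] := fps_neq0P Bkl.
exact: lt0r_neq0 (asum_gt0 x0 (Bx k l) Bn).
Qed.

Lemma asum_mx_lt x y : 0 <= x -> x < y -> mx_abscvg y ->
  exists i j, asum_mx x i j < asum_mx y i j.
Proof.
move=> x0 xy By; have [i [j [n [n0 Bn]]]] := nonconstant_entry.
by exists i, j; exact: asum_lt n0 Bn.
Qed.

Lemma asum_mx_perron x : 0 < x -> mx_abscvg x ->
  exists l v u, perron_pair (asum_mx x) l v u.
Proof.
by move=> x0 Bx; apply: perron; [exact: recursive_dim|exact: asum_mx_irreducible].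
Qed.

Lemma asum_mx_perron_lt x y l v u k v' u' : 0 < x -> x < y -> mx_abscvg y ->
  perron_pair (asum_mx x) l v u -> perron_pair (asum_mx y) k v' u' -> l < k.
Proof.
move=> x0 xy By pl pk; apply: perron_lt pl pk _ _.
  by apply: ler_asum_mx => //; exact: ltW.
by apply: asum_mx_lt => //; exact: ltW.
Qed.

Lemma asum_mx_largest x l v u : 0 < x -> mx_abscvg x ->
  perron_pair (asum_mx x) l v u -> largest_real_eigenvalue (mx_eval B x%:C) l.
Proof.
move=> x0 Bx pp; rewrite mx_eval_real ?(ltW x0) //.
apply: perron_largest pp; first exact: recursive_dim.
exact: asum_mx_ge0 (ltW x0) Bx.
Qed.

(** For x > 0 this says that the Perron eigenvalue of B(x) is at most 1. The witness u makes the
    condition visibly monotone in x and keeps it usable at x = 0, where the matrix need not be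
    irreducible. *)
Definition admissible (x : R) : Prop :=
  mx_abscvg x /\ exists2 u, (forall i, 0 < u i) &
    forall i, ract (asum_mx x) u i <= u i.

Lemma ler_ract (M N : 'I_m -> 'I_m -> R) u i : (forall i, 0 <= u i) ->
  (forall i j, M i j <= N i j) -> ract M u i <= ract N u i.
Proof. by move=> u0 MN; apply: ler_sum => j _; rewrite ler_wpM2r. Qed.

Lemma admissible_le x y : 0 <= x -> x <= y -> admissible y -> admissible x.
Proof.
move=> x0 xy [By [u u0 uE]]; split; first exact: mx_abscvg_le By.
exists u => // i; apply: le_trans (uE i); apply: ler_ract; last exact: ler_asum_mx.
by move=> j; exact: ltW.
Qed.

Lemma admissible_extend x y u : 0 <= x -> x < y -> mx_abscvg y ->
  (forall i, 0 < u i) -> (forall i, ract (asum_mx x) u i < u i) ->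
  exists2 z, x < z & admissible z.
Proof.
move=> x0 xy By u0 ux.
pose q i := ract (asum_mx y) u i; pose p i := ract (asum_mx x) u i.
have h0 i : 0 < 1 + `|q i - p i| by rewrite ltr_pwDl.
(* Convexity gives B(z) u <= (1 - t) p + t q, which is at most u as soon as t (q - p) <= u - p.
   Adding 1 to |q - p| avoids a zero denominator. *)
pose t := \big[Num.min/1]_i ((u i - p i) / (1 + `|q i - p i|)).
have t0 : 0 < t.
  by apply: lt_bigmin => // i _; rewrite divr_gt0 // subr_gt0; exact: ux.
have t1 : t <= 1 by exact: bigmin_le_id.
have ti i : t * (1 + `|q i - p i|) <= u i - p i.
  by rewrite -ler_pdivlMr //; exact: bigmin_le.
pose z := (1 - t) * x + t * y.
have xz : x < z.
  have -> : z = x + t * (y - x) by rewrite /z; ring.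
  by rewrite ltrDl mulr_gt0 // subr_gt0.
have zy : z <= y.
  have -> : z = y - (1 - t) * (y - x) by rewrite /z; ring.
  by rewrite gerBl mulr_ge0 // subr_ge0 // ltW.
exists z => //; split.
  by apply: mx_abscvg_le zy By; rewrite (le_trans x0) // ltW.
exists u => // i.
apply: le_trans (_ : (1 - t) * p i + t * q i <= _).
  rewrite /p /q /ract !mulr_sumr -big_split; apply: ler_sum => j _ /=.
  rewrite !mulrA -mulrDl ler_wpM2r //; first exact: ltW.
  by apply: asum_convex => //; [exact: ltW|rewrite ltW].
have := ti i; have := ler_wpM2l (ltW t0) (ler_norm (q i - p i)).
rewrite !mulrDr mulr1; lra.
Qed.

(* [u] solves [u = 1 + B(0) u], which exists because B(0) is nilpotent. *)
Lemma admissible_small : (0 < mx_radius B)%E -> exists2 x, 0 < x & admissible x.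
Proof.
move=> /lt_EFin_dense[y y0 yB].
have By : mx_abscvg y by move=> i j; apply: lt_mx_radius_abscvg => //; exact: ltW.
pose B0 := map_mx (@fps_coef0 C) B.
have [k Bk] := B0_nil; rewrite -/B0 in Bk.
pose U : 'cV[C]_m := (\sum_(h < k) B0 ^+ h) *m const_mx 1.
have UE : U = const_mx 1 + B0 *m U.
  have -> : B0 *m U = (\sum_(h < k) B0 ^+ h.+1) *m const_mx 1.
    rewrite /U mulmxA mulmx_sumr; congr (_ *m _); apply: eq_bigr => h _.
    by rewrite exprS.
  rewrite -{1}[const_mx 1]mul1mx -mulmxDl /U; congr (_ *m _).
  rewrite -[1%:M]/(B0 ^+ 0) -(big_ord_recl _ (fun h => B0 ^+ h)) big_ord_recr /= Bk.
  by rewrite addr0.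
have B00 i j : 0 <= B0 i j by rewrite mxE; exact: B_ge0.
have U0 i j : 0 <= U i j.
  by apply: (nilpotent_solution_ge0 B00 B0_nil _ UE) => a b; rewrite mxE ler01.
pose u i := normc (U i ord0).
have uE i : u i = 1 + ract (asum_mx 0) u i.
  apply: complexI; rewrite rmorphD rmorph_sum /= -normc_ge0_id //.
  rewrite {1}UE !mxE; congr (_ + _); apply: eq_bigr => j _.
  rewrite /asum_mx asum0 rmorphM /= -!normc_ge0_id // mxE //.
have u0 i : 0 < u i.
  rewrite uE ltr_pwDl // sumr_ge0 // => j _; rewrite mulr_ge0 ?normc_ge0 //.
  by rewrite /asum_mx asum0 normc_ge0.
apply: (@admissible_extend 0 y u) => // i.
by rewrite [ltRHS]uE ltrDr.
Qed.

(** A path from j to i with entries taken at x0 gives a constant c with c u_i <= u_j for every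
    admissible x >= x0 and every witness u, since the entries grow with x. With B_ij(x) u_j <= u_i
    this closes the cycle and bounds B_ij(x) by 1 / c. *)
Lemma admissible_bound x0 : 0 < x0 -> admissible x0 -> forall i j,
  exists k, forall x, x0 <= x -> admissible x -> asum_mx x i j <= k.
Proof.
move=> x00 [Bx0 _] i j.
have [M0 Mc] := asum_mx_irreducible x00 Bx0.
have [c c0 cP] : exists2 c, 0 < c & forall x u, x0 <= x -> mx_abscvg x ->
    (forall i, 0 < u i) -> (forall i, ract (asum_mx x) u i <= u i) -> c * u i <= u j.
  have /connectP[p] := Mc j i; elim: p j => [|k p IH] h /=.
    by move=> _ ->; exists 1 => // x u _ _ _ _; rewrite mul1r.
  case/andP => Mhk pp li; have [c c0 cP] := IH _ pp li.
  exists (asum_mx x0 h k * c); first by rewrite mulr_gt0 // lt_def M0 andbT.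
  move=> x u xx Bx u0 uE; apply: le_trans (uE h).
  rewrite -mulrA; apply: le_trans (_ : asum_mx x h k * u k <= _).
    rewrite ler_pM ?M0 ?mulr_ge0 ?(ltW c0) ?(ltW (u0 _)) //.
      by apply: ler_asum_mx => //; exact: ltW.
    exact: cP xx Bx u0 uE.
  rewrite /ract (bigD1 k) //= lerDl sumr_ge0 // => l _.
  by rewrite mulr_ge0 ?(ltW (u0 _)) // asum_mx_ge0 // (le_trans _ xx) // ltW.
exists c^-1 => x xx [Bx [u u0 uE]].
have x0' : 0 <= x by rewrite (le_trans _ xx) // ltW.
rewrite -[_^-1]mul1r ler_pdivlMr // -(ler_pM2r (u0 i)) mul1r.
apply: le_trans (uE i); rewrite -mulrA.
apply: le_trans (_ : asum_mx x i j * u j <= _).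
  by rewrite ler_wpM2l ?asum_mx_ge0 //; exact: cP xx Bx u0 uE.
rewrite /ract (bigD1 j) //= lerDl sumr_ge0 // => l _.
by rewrite mulr_ge0 ?(ltW (u0 _)) // asum_mx_ge0.
Qed.

Lemma critical_point : (0 < mx_radius B)%E -> exists r l v u,
  [/\ 0 < r, mx_abscvg r, perron_pair (asum_mx r) l v u, l <= 1 &
      l < 1 -> mx_radius B = r%:E].
Proof.
move=> Brad; have [x1 x10 ad1] := admissible_small Brad.
pose S := [set x | admissible x].
have Sub : has_ubound S.
  have [i [j [n [n0 Bn]]]] := nonconstant_entry.
  have [k kP] := admissible_bound x10 ad1 i j.
  have b0 : 0 < normc (B i j n) by rewrite normc_gt0.
  (* With b the chosen coefficient, b x <= b x^n <= B_ij(x) <= k for admissible x >= 1 and x >=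
     [x1]. The summands 1 and [x1] of the bound dispose of the smaller x. *)
  exists (1 + (x1 + `|k| / normc (B i j n))) => x Sx.
  have p0 : 0 <= `|k| / normc (B i j n) by rewrite divr_ge0 ?normc_ge0.
  have [x1x|/ltW xx1] := leP 1 x; last by have := ltW x10; lra.
  have [xx|/ltW xx] := leP x1 x; last by have := ltW x10; lra.
  have x0 : 0 <= x by exact: le_trans x1x.
  suff : x <= `|k| / normc (B i j n) by have := ltW x10; lra.
  rewrite ler_pdivlMr // (le_trans _ (ler_norm k)) // (le_trans _ (kP x xx Sx)) //.
  rewrite (le_trans _ (term_le_asum n x0 (Sx.1 i j))) // mulrC.
  rewrite ler_wpM2l ?normc_ge0 // -{1}[x]expr1.
  exact: ler_weXn2l.
pose r := sup S.
have x1r : x1 <= r by exact: ub_le_sup.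
have r0 : 0 < r by exact: lt_le_trans x1r.
have adlt x : 0 <= x -> x < r -> admissible x.
  move=> x0 xr; have [||y Sy yx] := @sup_adherent R S (r - x).
  - by rewrite subr_gt0.
  - by split => //; exists x1.
  by apply: admissible_le Sy => //; apply: ltW; rewrite opprB addrC subrK in yx.
have Br : mx_abscvg r.
  move=> i j; have [k kP] := admissible_bound x10 ad1 i j.
  (* A partial sum is a polynomial, so its bound for x < r passes to the left limit. The two
     summands bound it for x >= [x1] and for x < [x1]. *)
  exists (`|k| + asum_mx x1 i j) => N.
  have cv : psum (B i j) x N @[x --> r^'-] --> psum (B i j) r N.
    by apply: cvg_at_left_filter; exact: psum_continuous.
  apply: (cvgr_to_le cv); near=> x.
  have xr : x < r by near: x; exact: nbhs_left_lt.
  have x0 : 0 <= x by near: x; exact: nbhs_left_ge.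
  have ax := adlt x x0 xr; have a0 := asum_mx_ge0 (ltW x10) ad1.1 i j.
  have [xx|/ltW xx] := leP x1 x.
    rewrite (le_trans (psum_le_asum N (ax.1 i j))) // (le_trans (kP x xx ax)) //.
    by have := ler_norm k; lra.
  rewrite (le_trans (ler_psum _ _ x0 xx)) //.
  rewrite (le_trans (psum_le_asum N (ad1.1 i j))) //.
  by rewrite lerDr.
have [l [v [u pp]]] := asum_mx_perron r0 Br.
have [v0 u0 vE uE] := pp.
exists r, l, v, u; split => //.
  (* If l > 1, then v < v B(r) in every coordinate, and this survives truncating the series and then
     slightly decreasing x. At such an x some w > 0 has B(x) w <= w, so that v w < v B(x) w <= v
     w. *)
  rewrite leNgt; apply/negP => l1.
  have H1 : \forall N \near \oo, forall j,
      v j < lact (fun i j => psum (B i j) r N) v j.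
    apply: filter_forall => j.
    have cv : (fun N => lact (fun i j => psum (B i j) r N) v j) @ \oo -->
        lact (asum_mx r) v j.
      rewrite /lact; apply: cvg_sumr => i.
      by apply: cvgM; [exact: cvg_cst|apply: psum_cvg => //; exact: ltW].
    by apply: (cvgr_gt _ cv); rewrite vE ltr_pMl.
  have [N _ /(_ N (leqnn N)) /= HN] := H1.
  have H2 : \forall x \near r^'-, forall j,
      v j < lact (fun i j => psum (B i j) x N) v j.
    apply: filter_forall => j.
    have cv : lact (fun i j => psum (B i j) x N) v j @[x --> r^'-] -->
        lact (fun i j => psum (B i j) r N) v j.
      rewrite /lact; apply: cvg_sumr => i.
      apply: cvgM; first exact: cvg_cst.
      by apply: cvg_at_left_filter; exact: psum_continuous.
    exact: (cvgr_gt _ cv).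
  have [x [[xr x0] Hx]] : exists x, (x < r /\ 0 <= x) /\
      forall j, v j < lact (fun i j => psum (B i j) x N) v j.
    apply: (@filter_ex _ (r^'-)); near=> x; split; last by near: x.
    split; near: x; [exact: nbhs_left_lt|exact: nbhs_left_ge].
  have [Bx [w w0 wE]] := adlt x x0 xr.
  pose i0 := Ordinal recursive_dim.
  have : \sum_j v j * w j < \sum_j v j * w j; last by rewrite ltxx.
  apply: lt_le_trans (_ : \sum_j lact (asum_mx x) v j * w j <= _).
    apply: (@ltr_sum_at _ _ _ _ i0) => [j|]; rewrite ?ler_pM2r ?ltr_pM2r //.
      rewrite (le_trans (ltW (Hx j))) //; apply: ler_sum => i _.
      by rewrite ler_wpM2l ?psum_le_asum // ltW.
    rewrite (lt_le_trans (Hx i0)) //; apply: ler_sum => i _.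
    by rewrite ler_wpM2l ?psum_le_asum // ltW.
  by rewrite lact_ract; apply: ler_sum => i _; rewrite ler_wpM2l // ltW.
move=> l1; apply/eqP; rewrite eq_le; apply/andP; split; last first.
  by apply: le_mx_radius => i j; apply: abscvg_radius => //; exact: ltW.
rewrite leNgt; apply/negP => /lt_EFin_dense[y ry yB].
have By : mx_abscvg y.
  move=> i j; apply: lt_mx_radius_abscvg yB.
  by rewrite (le_trans _ (ltW ry)) // ltW.
have ur i : ract (asum_mx r) u i < u i by rewrite uE gtr_pMl.
have [z rz Sz] := admissible_extend (ltW r0) ry By u0 ur.
suff : z <= r by rewrite leNgt rz.
exact: ub_le_sup.
Unshelve. all: by end_near.
Qed.

End CriticalPoint.

(** * Singularities on the circle of convergence *)

Section Alignment.
Variable R : realType.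
Local Notation C := R[i].
Local Open Scope complex_scope.
Local Notation normc := (@ComplexField.Normc.normc R).
Local Notation Re := (@complex.Re R).

Lemma eval_term (f : fps C) z n : abscvg f (normc z) ->
  normc (fps_eval f z - f n * z ^+ n) <=
  asum f (normc z) - normc (f n) * normc z ^+ n.
Proof.
move=> fz; have := eval_tail n.+1 fz; rewrite csumS psumS => h1.
have h2 := csum_norm f z n.
have -> : fps_eval f z - f n * z ^+ n =
  (fps_eval f z - (csum f z n + f n * z ^+ n)) + csum f z n by ring.
by rewrite (le_trans (normcD _ _)) //; lra.
Qed.

Lemma Re_ge_normc (w : C) : normc w <= Re w -> w = (normc w)%:C.
Proof.
move=> h; have h0 : 0 <= Re w by exact: le_trans (normc_ge0 w) h.
have hE : normc w = Re w.
  by apply/eqP; rewrite eq_le h -[leLHS]ger0_norm // normc_Re.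
rewrite hE; have : normc w ^+ 2 = Re w ^+ 2 by rewrite hE.
case: w {h h0 hE} => a b /=.
rewrite sqr_sqrtr ?addr_ge0 ?sqr_ge0 // => /eqP.
by rewrite -subr_eq0 addrAC subrr add0r sqrf_eq0 => /eqP ->.
Qed.

Lemma Re_le_normc (w : C) : Re w <= normc w.
Proof. exact: le_trans (ler_norm _) (normc_Re w). Qed.

Lemma ReD (a b : C) : Re (a + b) = Re a + Re b.
Proof. by case: a; case: b. Qed.

Lemma Re_sum (I : Type) (r : seq I) (F : I -> C) :
  Re (\sum_(i <- r) F i) = \sum_(i <- r) Re (F i).
Proof. by elim/big_rec2: _ => [//|i a b _ <-]; rewrite ReD. Qed.

(** The terms other than the n-th contribute at most |c| times their moduli to the real part, so the
    n-th term, multiplied by c, must have its modulus as real part. *)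
Lemma aligned_terms (c : C) (f : fps C) z n : (forall n, 0 <= f n) ->
  abscvg f (normc z) -> normc c * asum f (normc z) <= Re (c * fps_eval f z) ->
  f n != 0 -> c * z ^+ n = (normc c * normc z ^+ n)%:C.
Proof.
move=> f0 fz h fn.
have : c * (f n * z ^+ n) = (normc (c * (f n * z ^+ n)))%:C.
  apply: Re_ge_normc; rewrite !normcM normcX.
  have h1 := ler_wpM2l (normc_ge0 c) (eval_term n fz).
  rewrite -normcM [leRHS]mulrBr in h1.
  have h2 := Re_le_normc (c * (fps_eval f z - f n * z ^+ n)).
  have E : Re (c * fps_eval f z) =
      Re (c * (f n * z ^+ n)) + Re (c * (fps_eval f z - f n * z ^+ n)).
    by rewrite -ReD; congr Re; ring.
  by rewrite E in h; lra.
rewrite !normcM normcX mulrCA [X in X%:C]mulrCA [X in _ = X]rmorphM /=.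
rewrite -normc_ge0_id //; exact: mulfI.
Qed.

End Alignment.

Section Phases.
Variables (R : realType) (m : nat) (B : 'M[fps R[i]]_m).
Local Notation C := R[i].
Local Open Scope complex_scope.
Local Notation normc := (@ComplexField.Normc.normc R).
Hypothesis B_ge0 : forall i j n, 0 <= B i j n.

(* Equality in |y| <= |y| |B(z)| <= |y| B(|z|) forces every term of every series
   B_ij(z) to have the same argument up to a diagonal conjugation. *)
Lemma kernel_phases (z : C) l v u (y : 'rV[C]_m) :
  mx_abscvg B (normc z) -> irreducible (asum_mx B (normc z)) ->
  perron_pair (asum_mx B (normc z)) l v u -> l <= 1 -> 0 < normc z ->
  y != 0 -> y *m mx_eval B z = y ->
  l = 1 /\ exists2 d : 'I_m -> C, (forall i, d i != 0) &
    forall i j n, B i j n != 0 -> d i * (z / (normc z)%:C) ^+ n = d j.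
Proof.
move=> Bx Birr pp l1 z0 yn yE; have [v0 u0 vE uE] := pp.
set x := normc z in z0 Bx Birr pp vE uE *.
pose a i := normc (y ord0 i).
have a0 i : 0 <= a i by exact: normc_ge0.
have an : exists i, a i != 0.
  by have /rV0Pn[i yi] := yn; exists i; rewrite normc_eq0.
have yj j : y ord0 j = \sum_i y ord0 i * fps_eval (B i j) z.
  by rewrite -{1}yE mxE; apply: eq_bigr => i _; rewrite mxE.
have nb i j : normc (y ord0 i * fps_eval (B i j) z) <= a i * asum_mx B x i j.
  by rewrite normcM; apply: ler_wpM2l; [exact: a0|exact: eval_norm].
have sub j : a j <= lact (asum_mx B x) a j.
  rewrite {1}/a yj (le_trans (normc_sum _ _ _)) //.
  by apply: ler_sum => i _; exact: nb.
have l1' : l = 1.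
  apply/eqP; rewrite eq_le l1; apply: (perron_subeigen pp (y := a)).
  by split => // j; rewrite mul1r.
split => //; subst l.
(* Paired with u > 0, the slack in |y| <= |y| B(|z|) has sum zero, so it vanishes in each
   coordinate. *)
have aE j : lact (asum_mx B x) a j = a j.
  have S0 : \sum_j (lact (asum_mx B x) a j - a j) * u j = 0.
    under eq_bigr do rewrite mulrBl; rewrite sumrB lact_ract.
    by under eq_bigr do rewrite uE mul1r; rewrite subrr.
  have t0 k : true -> 0 <= (lact (asum_mx B x) a k - a k) * u k.
    by move=> _; rewrite mulr_ge0 ?subr_ge0 // ltW.
  have /eqP := S0; rewrite psumr_eq0 // => /allP /(_ j (mem_index_enum j)) /=.
  by rewrite mulf_eq0 (gt_eqF (u0 j)) orbF subr_eq0 => /eqP.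
have ap i : 0 < a i.
  by apply: (@subinvariant_gt0 _ _ (asum_mx B x) a 1) => // j; rewrite aE mul1r.
have yi0 i : y ord0 i != 0 by rewrite -normc_eq0 gt_eqF // ap.
have aC0 i : (a i)%:C != 0.
  by rewrite -(rmorph0 (real_complex R)) (inj_eq (@complexI R)) gt_eqF.
(* The phases of the coordinates of y. *)
exists (fun i => y ord0 i / (a i)%:C).
  by move=> i; rewrite mulf_neq0 ?invr_eq0.
move=> i j n Bn.
(* The rotation [e] makes y_j positive. Then a_j is a sum of real parts, each at most a_i B_ij(|z|),
   and these bounds also add up to a_j; so each is attained. *)
pose e := (a j)%:C / y ord0 j.
have ne : normc e = 1.
  rewrite /e normcM ComplexField.Normc.normcV normc_real (ger0_norm (a0 j)).
  by rewrite divff // gt_eqF.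
have eE : (a j)%:C = \sum_i (e * y ord0 i) * fps_eval (B i j) z.
  transitivity (e * y ord0 j); first by rewrite /e divfK.
  by rewrite {1}yj mulr_sumr; apply: eq_bigr => k _; rewrite mulrA.
have nee k : normc (e * y ord0 k) = a k by rewrite normcM ne mul1r.
have Re_le k : complex.Re (e * y ord0 k * fps_eval (B k j) z) <= a k * asum_mx B x k j.
  by rewrite (le_trans (Re_le_normc _)) // -mulrA normcM ne mul1r.
have Re_eq : a i * asum_mx B x i j <= complex.Re (e * y ord0 i * fps_eval (B i j) z).
  have h1 : \sum_k (a k * asum_mx B x k j -
       complex.Re (e * y ord0 k * fps_eval (B k j) z)) = 0.
    rewrite sumrB -Re_sum -eE /= -[X in X - _]/(lact (asum_mx B x) a j) aE.
    exact: subrr.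
  have t0 k : true -> 0 <= a k * asum_mx B x k j -
       complex.Re (e * y ord0 k * fps_eval (B k j) z).
    by move=> _; rewrite subr_ge0.
  move/eqP: h1; rewrite psumr_eq0 // => /allP /(_ i (mem_index_enum i)) /=.
  by rewrite subr_eq0 => /eqP ->.
have := @aligned_terms R (e * y ord0 i) (B i j) z n (B_ge0 i j) (Bx i j).
rewrite nee => /(_ Re_eq Bn); rewrite -/x => H.
have xC0 : x%:C != 0 by rewrite -(rmorph0 (real_complex R)) (inj_eq (@complexI R)) gt_eqF.
move: H; rewrite rmorphM rmorphXn /= /e => H.
rewrite expr_div_n.
apply: (@mulfI _ ((a j)%:C / y ord0 j * (a i)%:C * x%:C ^+ n)).
  by rewrite !mulf_neq0 ?invr_eq0 ?expf_neq0 //.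
transitivity ((a j)%:C / y ord0 j * y ord0 i * z ^+ n).
  by field; rewrite ?yi0 ?aC0 ?expf_neq0.
by rewrite H; field; rewrite ?yi0 ?aC0 ?expf_neq0.
Qed.

End Phases.

(** * Evaluation of matrices and analytic continuation of the solution *)

Section MxEval.
Variable R : realType.
Local Notation C := R[i].
Local Notation normc := (@ComplexField.Normc.normc R).

Lemma mx_evalM p q s (M : 'M[fps C]_(p, q)) (N : 'M[fps C]_(q, s)) z :
  (forall i j, abscvg (M i j) (normc z)) -> (forall i j, abscvg (N i j) (normc z)) ->
  mx_eval (M *m N) z = mx_eval M z *m mx_eval N z.
Proof.
move=> Mz Nz; apply/matrixP => i j; rewrite !mxE eval_sum.
  by apply: eq_bigr => k _; rewrite !mxE evalM.
by move=> k _; apply: abscvgM => //; exact: normc_ge0.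
Qed.

Lemma mx_evalD p q (M N : 'M[fps C]_(p, q)) z :
  (forall i j, abscvg (M i j) (normc z)) -> (forall i j, abscvg (N i j) (normc z)) ->
  mx_eval (M + N) z = mx_eval M z + mx_eval N z.
Proof. by move=> Mz Nz; apply/matrixP => i j; rewrite !mxE evalD. Qed.

Lemma mx_eval_1B p (M : 'M[fps C]_p) z :
  (forall i j, abscvg (M i j) (normc z)) ->
  mx_eval (1%:M - M) z = 1%:M - mx_eval M z.
Proof.
move=> Mz; apply/matrixP => i j; rewrite !mxE evalD.
- rewrite evalN //; congr (_ - _).
  by case: (i == j); rewrite ?mulr1n ?mulr0n ?eval_1 ?eval_0.
- by case: (i == j); [exact: abscvg_1|exact: abscvg_0].
- exact: abscvgN.
Qed.

Lemma abscvg_1B p (M : 'M[fps C]_p) x : 0 <= x ->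
  (forall i j, abscvg (M i j) x) -> forall i j, abscvg ((1%:M - M) i j) x.
Proof.
move=> x0 Mx i j; rewrite !mxE; apply: abscvgD => //; last exact: abscvgN.
by case: (i == j); [exact: abscvg_1|exact: abscvg_0].
Qed.

Lemma mx_eval1 p z : mx_eval (1%:M : 'M[fps C]_p) z = 1%:M.
Proof.
apply/matrixP => i j; rewrite !mxE.
by case: (i == j); rewrite ?mulr1n ?mulr0n ?eval_1 ?eval_0.
Qed.

Lemma regular_family (I : finType) (F : I -> fps C) z :
  (forall i, regular_at (F i) z) ->
  exists G : I -> fps C, exists2 r : R, 0 < r & forall i w, normc (w - z) < r ->
    fps_cvg (G i) (w - z) /\
    (((normc w)%:E < fps_radius (F i))%E -> fps_eval (F i) w = fps_eval (G i) (w - z)).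
Proof.
move=> /choice[G GP].
have /choice[r rP] : forall i, exists r : R, 0 < r /\
    forall w, normc (w - z) < r -> fps_cvg (G i) (w - z) /\
    (((normc w)%:E < fps_radius (F i))%E -> fps_eval (F i) w = fps_eval (G i) (w - z)).
  by move=> i; have [r r0 rP] := GP i; exists r.
exists G, (\big[Num.min/1]_i r i).
  by apply: lt_bigmin => // i _; exact: (rP i).1.
move=> i w wz; apply: (rP i).2; apply: lt_le_trans wz _; exact: bigmin_le.
Qed.

End MxEval.

Section LocalSolution.
Variables (R : realType) (m : nat).
Variables (A Y : 'cV[fps R[i]]_m) (B : 'M[fps R[i]]_m).
Local Notation C := R[i].
Local Notation normc := (@ComplexField.Normc.normc R).

(** Near z the continuation of Y is (Id - b)^-1 a, with a and b the Taylor series at z of the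
    continuations of A and B. The constant term of b is B(z) by [regular_value], so the inverse
    exists as a matrix of convergent series. *)
Lemma solution_regular (z : C) : Y = A + B *m Y ->
  (normc z)%:E = mx_radius Y -> 0 < normc z ->
  (mx_radius Y <= mx_radius A)%E -> (mx_radius Y <= mx_radius B)%E ->
  (forall i, fps_radius (Y i ord0) = mx_radius Y) ->
  (forall i, regular_at (A i ord0) z) -> (forall i j, regular_at (B i j) z) ->
  mx_abscvg B (normc z) -> \det (1%:M - mx_eval B z) != 0 ->
  forall i, regular_at (Y i ord0) z.
Proof.
move=> YE zY z0 YA YB Yr Areg Breg Bz dB i0.
have [GA [ra ra0 GAP]] := regular_family Areg.
have [GB' [rb rb0 GBP]] :=
  @regular_family R ('I_m * 'I_m)%type (fun k => B k.1 k.2) z (fun k => Breg k.1 k.2).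
pose ga : 'cV[fps C]_m := \col_i GA i.
pose gb : 'M[fps C]_m := \matrix_(i, j) GB' (i, j).
pose r := Num.min ra rb; pose x := r / 2.
have r0 : 0 < r by rewrite lt_min ra0.
have x0 : 0 < x by rewrite divr_gt0.
have xr : x < r by rewrite ltr_pdivrMr // ltr_pMr // ltr1n.
have gax i j : abscvg (ga i j) x.
  rewrite mxE; apply: (@cvg_disc_abscvg _ _ ra) => // [w wr|].
    by have [] := GAP i (w + z); rewrite addrK.
  by rewrite (ltW x0) (lt_le_trans xr) // ge_min lexx.
have gbx i j : abscvg (gb i j) x.
  rewrite mxE; apply: (@cvg_disc_abscvg _ _ rb) => // [w wr|].
    by have [] := GBP (i, j) (w + z); rewrite addrK.
  by rewrite (ltW x0) (lt_le_trans xr) // ge_min lexx orbT.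
have gb0 : map_mx (@fps_coef0 C) (1%:M - gb) = 1%:M - mx_eval B z.
  rewrite map_mxB map_mx1; congr (_ - _); apply/matrixP => i j.
  rewrite !mxE; symmetry; apply: (@regular_value R (B i j) _ z rb) => //.
    by rewrite zY (le_trans YB) // mx_radius_le.
  exact: (GBP (i, j)).
have [F [FV [y /andP[y0 yx] Fy]]] : exists F : 'M[fps C]_m,
    F *m (1%:M - gb) = 1%:M /\ exists2 y, 0 < y <= x & forall i j, abscvg (F i j) y.
  have [uG Fy] := abscvg_invmx x0 (abscvg_1B (ltW x0) gbx) (eq_ind_r (fun M => \det M != 0) dB gb0).
  by exists (invmx (1%:M - gb)); split; first exact: mulVmx uG.
pose gy := F *m ga.
exists (gy i0 ord0), y => // w wz; set t := w - z in wz *.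
have ty : normc t <= y by exact: ltW.
have t0 := normc_ge0 t.
have gat i j : abscvg (ga i j) (normc t).
  by apply: abscvg_le (gax i j) => //; exact: le_trans yx.
have gbt i j : abscvg (gb i j) (normc t).
  by apply: abscvg_le (gbx i j) => //; exact: le_trans yx.
have Ft i j : abscvg (F i j) (normc t) by exact: abscvg_le (Fy i j).
have gyt i j : abscvg (gy i j) (normc t).
  by rewrite mxE; apply: abscvg_sum => // k _; exact: abscvgM.
split; first exact: abscvg_cvg.
(* Regularity tests w inside the disc of one entry, while the equation needs every entry of Y at w:
   this is where equality of the radii enters. *)
rewrite Yr => wY; have w0 := normc_ge0 w.
have tr : normc t < r by rewrite (lt_le_trans wz) // (le_trans yx) // ltW.
have tra : normc t < ra by rewrite (lt_le_trans tr) // ge_min lexx.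
have trb : normc t < rb by rewrite (lt_le_trans tr) // ge_min lexx orbT.
have Yw i j : abscvg (Y i j) (normc w) by apply: lt_mx_radius_abscvg wY.
have Aw i j : abscvg (A i j) (normc w).
  by apply: lt_mx_radius_abscvg (lt_le_trans wY YA).
have Bw i j : abscvg (B i j) (normc w).
  by apply: lt_mx_radius_abscvg (lt_le_trans wY YB).
have Ae : mx_eval A w = mx_eval ga t.
  apply/matrixP => i j; rewrite !mxE ord1; apply: (GAP i w tra).2.
  by rewrite (lt_le_trans wY) // (le_trans YA) // mx_radius_le.
have Be : mx_eval B w = mx_eval gb t.
  apply/matrixP => i j; rewrite !mxE; apply: (GBP (i, j) w trb).2.
  by rewrite (lt_le_trans wY) // (le_trans YB) // mx_radius_le.
have Ye : (1%:M - mx_eval gb t) *m mx_eval Y w = mx_eval ga t.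
  have BYw i j : abscvg ((B *m Y) i j) (normc w).
    by rewrite mxE; apply: (abscvg_sum _ w0) => k _; apply: (abscvgM w0).
  by rewrite mulmxBl mul1mx -Be -Ae {1}YE (mx_evalD Aw BYw) (mx_evalM Bw Yw) addrK.
have FG : mx_eval F t *m (1%:M - mx_eval gb t) = 1%:M.
  by rewrite -(mx_eval_1B gbt) -(mx_evalM Ft (abscvg_1B t0 gbt)) FV mx_eval1.
have : mx_eval Y w = mx_eval gy t.
  by rewrite (mx_evalM Ft gat) -Ye mulmxA FG mul1mx.
by move/matrixP => /(_ i0 ord0); rewrite !mxE.
Qed.

End LocalSolution.

(** * The linear system *)

Section Resolvent.
Variables (R : realType) (m : nat) (B : 'M[fps R[i]]_m).
Local Notation C := R[i].
Local Notation F := (invmx (1%:M - B)).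

Hypothesis B_ge0 : forall i j n, 0 <= B i j n.
Hypothesis B0_nil : is_nilpotent (map_mx (@fps_coef0 C) B).
Hypothesis B_rec : ~ is_nilpotent B.
Hypothesis B_conn : forall i j, connect (dependency B) i j.

(** A row vector with y = y B(0) satisfies y = y B(0)^k = 0, so the constant term Id - B(0) is
    invertible. *)
Lemma resolvent_unit : 1%:M - B \in unitmx.
Proof.
rewrite unitmxE; apply: fps_unit_coef0.
have -> : (\det (1%:M - B)) 0%N = \det (map_mx (@fps_coef0 C) (1%:M - B)).
  by rewrite det_map_mx.
rewrite map_mxB map_mx1.
have [k Bk] := B0_nil; set B0 := map_mx _ B in Bk *.
apply/det0P => -[y yn]; rewrite mulmxBr mulmx1 => /subr0_eq yE.
move/eqP: yn; apply.
have -> : y = y *m B0 ^+ k.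
  elim: k {Bk} => [|k IH]; first by rewrite expr0 mulmx1.
  by rewrite exprS -[B0 * _]/(B0 *m _) mulmxA -yE.
by rewrite Bk mulmx0.
Qed.

(** The resolvent thereby solves Y = Id + B Y, with m columns, and the coefficientwise bounds for
    solutions apply to it. *)
Lemma resolventE : F = 1%:M + B *m F.
Proof.
have := mulmxV resolvent_unit; rewrite mulmxBl mul1mx => /eqP.
by rewrite subr_eq => /eqP.
Qed.

Lemma resolvent_ge0 i j n : 0 <= F i j n.
Proof.
apply: (solution_ge0 _ B_ge0 B0_nil resolventE) => k l [|h]; rewrite mxE;
  by case: (k == l); rewrite ?ler01.
Qed.

Lemma one_coef_ge0 (i j : 'I_m) n : 0 <= (1%:M : 'M[fps C]_m) i j n.
Proof. by rewrite mxE; case: (i == j); case: n => [|n]; rewrite /= ?ler01. Qed.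

Lemma resolvent_diag0 i : F i i 0%N != 0.
Proof.
have := solution_geA one_coef_ge0 B_ge0 B0_nil resolventE i i 0.
rewrite mxE eqxx => h; apply: lt0r_neq0; apply: lt_le_trans h.
exact: ltr01.
Qed.

(** The coefficients of the entry weigh the walks from i to j without cancellation, and strong
    connectivity provides a walk. *)
Lemma resolvent_neq0 i j : exists n, F i j n != 0.
Proof.
have /connectP[p] := B_conn i j; elim: p i => [|k p IH] i /=.
  by move=> _ ->; exists 0%N; exact: resolvent_diag0.
case/andP => Bik pp lj; have [b Fb] := IH _ pp lj.
have [a Ba] := fps_neq0P Bik; exists (a + b)%N.
have := solution_geB one_coef_ge0 B_ge0 B0_nil resolventE i k j a b.
apply: contraTneq => ->; rewrite lt_geF // lt_def mulf_neq0 //=.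
by rewrite mulr_ge0 ?resolvent_ge0.
Qed.

(** If the periods of B have gcd 0, a closed walk at i through a nonconstant entry gives the i-th
    diagonal entry of the resolvent a nonzero coefficient of positive index. As its valuation is 0,
    its period is positive. *)
Lemma qB_gt0 : (0 < qB B)%N.
Proof.
rewrite /qB; case: ifP => [|_]; first by rewrite lt0n.
have [i [j [n [n0 Bn]]]] := nonconstant_entry B0_nil B_rec.
have [b Fb] := resolvent_neq0 j i.
have Fnb : F i i (n + b)%N != 0.
  have := solution_geB one_coef_ge0 B_ge0 B0_nil resolventE i j i n b.
  apply: contraTneq => ->; rewrite lt_geF // lt_def mulf_neq0 //=.
  by rewrite mulr_ge0 ?resolvent_ge0.
have [_ /(_ 0%N (resolvent_diag0 i))] := fps_valP Fnb.
rewrite leqn0 => /eqP v0.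
have := period_dvd Fnb; rewrite v0 subn0 => pd.
have p0 : (0 < fps_period (F i i))%N by apply: dvdn_gt0 pd; rewrite addn_gt0 n0.
exact: dvdn_gt0 p0 (big_gcdn_dvd (fun i => fps_period (F i i)) i).
Qed.

Section Rotation.
Variables (w : C) (d : 'I_m -> C).
Hypotheses (w0 : w != 0) (d0 : forall i, d i != 0).
Hypothesis phase : forall i j n, B i j n != 0 -> d i * w ^+ n = d j.

(* B(wz) is conjugate to B(z) by diag(d), hence so are the resolvents, and
   conjugation by a diagonal matrix fixes the diagonal. *)
Lemma resolvent_diag_rotation i n : F i i n != 0 -> w ^+ n = 1.
Proof.
(* [G] is the conjugate by diag(d) of the resolvent at wz; it solves the resolvent equation for B,
   whose only solution is the resolvent itself. *)
pose G : 'M[fps C]_m := \matrix_(i, j) Fps (fun n => d i * w ^+ n / d j * F i j n).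
have GC k l h : G k l h = d k * w ^+ h / d l * F k l h by rewrite mxE.
have GE : G = 1%:M + B *m G.
  apply/matrixP => k l; apply: fpsP => h; rewrite GC.
  rewrite (solution_coefE resolventE) mulrDr.
  transitivity ((1%:M : 'M[fps C]_m) k l h +
      \sum_p \sum_(a < h.+1) B k p a * G p l (h - a)%N); last first.
    rewrite [in RHS]mxE; congr (_ + _).
    by rewrite mxE fps_sumE.
  congr (_ + _).
    rewrite mxE; have [->|_] := eqVneq k l; last by rewrite mulr0.
    by case: h => [|h]; rewrite ?mulr0 // expr0 mulr1 divff ?mul1r.
  rewrite mulr_sumr; apply: eq_bigr => p _; rewrite mulr_sumr.
  apply: eq_bigr => a _; rewrite GC.
  have [->|Ba] := eqVneq (B k p a) 0; first by rewrite !mul0r mulr0.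
  have ah : (a <= h)%N by rewrite -ltnS.
  by rewrite -(phase Ba) -{1}(subnKC ah) exprD; ring.
have FG : G = F.
  have : (1%:M - B) *m G = 1%:M by rewrite mulmxBl mul1mx {1}GE addrK.
  by move/(congr1 (mulmx F)); rewrite mulmxA mulVmx ?resolvent_unit // mul1mx mulmx1.
move=> Fn; have := congr1 (fun M : 'M[fps C]_m => M i i n) FG.
have dw : d i * w ^+ n / d i = w ^+ n by rewrite mulrAC divff // mul1r.
rewrite GC dw => /eqP.
by rewrite -subr_eq0 -{2}[F i i n]mul1r -mulrBl mulf_eq0 (negbTE Fn) orbF subr_eq0 => /eqP.
Qed.

Lemma qB_root : w ^+ qB B = 1.
Proof.
have wu : w \is a GRing.unit by rewrite unitfE.
rewrite /qB; case: ifP => _; last first.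
  apply: expr_big_gcdn => i _; apply: expr_period => // n k Fn Fk.
  by rewrite (resolvent_diag_rotation Fn) (resolvent_diag_rotation Fk).
apply: expr_big_gcdn => i _; apply: expr_big_gcdn => j _.
apply: expr_period => // n k Bn Bk; apply: (mulfI (d0 i)).
by rewrite (phase Bn) (phase Bk).
Qed.

End Rotation.
End Resolvent.

(** * Radius and dominant singularities of the solution *)

Section SolutionRadius.
Variables (R : realType) (m : nat).
Variables (A Y : 'cV[fps R[i]]_m) (B : 'M[fps R[i]]_m).
Local Notation C := R[i].
Local Open Scope complex_scope.
Local Notation normc := (@ComplexField.Normc.normc R).

Hypothesis irr : irreducible_system A B.
Hypothesis sol : gf_solution A B Y.

Lemma system_A_ge0 i j n : 0 <= A i j n.
Proof. by have [[_ [A0 _] _ _] _ _ _] := irr; rewrite (ord1 j). Qed.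

Lemma system_B_ge0 i j n : 0 <= B i j n.
Proof. by have [[_ [_ B0] _ _] _ _ _] := irr. Qed.

Lemma system_B0_nilpotent : is_nilpotent (map_mx (@fps_coef0 C) B).
Proof.
have [[_ _ _ Bn] _ _ _] := irr.
suff -> : map_mx (@fps_coef0 C) B = mx_eval B 0 by [].
by apply/matrixP => i j; rewrite !mxE eval0.
Qed.

Lemma system_B_recursive : ~ is_nilpotent B.
Proof. by have [] := irr. Qed.

Lemma system_B_connected i j : connect (dependency B) i j.
Proof. by have [] := irr. Qed.

Lemma solution_eq : Y = A + B *m Y.
Proof. by have [] := sol. Qed.

Lemma solution_coef_ge0 i j n : 0 <= Y i j n.
Proof.
exact: solution_ge0 system_A_ge0 system_B_ge0 system_B0_nilpotent solution_eq i j n.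
Qed.

Lemma solution_neq0 i : exists n, Y i ord0 n != 0.
Proof. by have [_ zf _ _] := irr; apply: fps_neq0P; exact: zf sol i. Qed.

Lemma abscvg_dom (f g : fps C) c k x : 0 < c -> 0 < x ->
  (forall n, c * normc (g n) <= normc (f (n + k)%N)) -> abscvg f x -> abscvg g x.
Proof.
move=> c0 x0 fg fx; have p0 : 0 < c * x ^+ k by rewrite mulr_gt0 ?exprn_gt0.
exists (asum f x / (c * x ^+ k)) => N; rewrite ler_pdivlMr //.
apply: le_trans (psum_le_asum (k + N) fx).
rewrite /psum big_split_ord /=; apply: ler_wpDl.
  by apply: sumr_ge0 => i _; rewrite psum_term_ge0 // ltW.
rewrite mulr_suml; apply: ler_sum => n _.
rewrite (addnC k).
have -> : normc (g n) * x ^+ n * (c * x ^+ k) = c * normc (g n) * x ^+ (n + k).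
  by rewrite exprD; ring.
by rewrite ler_wpM2r ?exprn_ge0 ?(ltW x0).
Qed.

Lemma radius_Y_le_A i : (fps_radius (Y i ord0) <= fps_radius (A i ord0))%E.
Proof.
apply: radius_mono => x x0; apply: (@abscvg_dom _ _ 1 0) => // n.
rewrite mul1r addn0 le_normc ?system_A_ge0 //.
exact: solution_geA system_A_ge0 system_B_ge0 system_B0_nilpotent solution_eq i ord0 n.
Qed.

Lemma radius_Y_le_B i j : (fps_radius (Y i ord0) <= fps_radius (B i j))%E.
Proof.
have [k Yk] := solution_neq0 j.
apply: radius_mono => x x0; apply: (@abscvg_dom _ _ (normc (Y j ord0 k)) k) => //.
  by rewrite normc_gt0.
move=> n; rewrite -normcM mulrC le_normc ?mulr_ge0 ?system_B_ge0 ?solution_coef_ge0 //.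
exact: solution_geB system_A_ge0 system_B_ge0 system_B0_nilpotent solution_eq i j ord0 n k.
Qed.

Lemma radius_Y_edge i j : B i j != 0 ->
  (fps_radius (Y i ord0) <= fps_radius (Y j ord0))%E.
Proof.
move=> /fps_neq0P[a Ba].
apply: radius_mono => x x0; apply: (@abscvg_dom _ _ (normc (B i j a)) a) => //.
  by rewrite normc_gt0.
move=> n; rewrite -normcM le_normc ?mulr_ge0 ?system_B_ge0 ?solution_coef_ge0 // addnC.
exact: solution_geB system_A_ge0 system_B_ge0 system_B0_nilpotent solution_eq i j ord0 a n.
Qed.

(** The radius does not decrease along an edge of the dependency graph, and every j is reachable
    from every i. *)
Lemma radius_YE i : fps_radius (Y i ord0) = mx_radius Y.
Proof.
apply/eqP; rewrite eq_le mx_radius_le andbT; apply: le_mx_radius => j k.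
rewrite (ord1 k); have /connectP[p] := system_B_connected i j.
elim: p i => [|h p IH] i /=; first by move=> _ ->.
by case/andP => Bih pp lj; apply: le_trans (radius_Y_edge Bih) (IH _ pp lj).
Qed.

Lemma mx_radius_Y_le_A : (mx_radius Y <= mx_radius A)%E.
Proof.
by apply: le_mx_radius => i j; rewrite (ord1 j) -(radius_YE i) radius_Y_le_A.
Qed.

Lemma mx_radius_Y_le_B : (mx_radius Y <= mx_radius B)%E.
Proof.
by apply: le_mx_radius => i j; rewrite -(radius_YE i) radius_Y_le_B.
Qed.

Lemma subcritical_abscvg x l v u i : 0 < x -> (forall i, abscvg (A i ord0) x) ->
  mx_abscvg B x -> perron_pair (asum_mx B x) l v u -> l < 1 ->
  abscvg (Y i ord0) x.
Proof.
move=> x0 Ax Bx [v0 u0 vE uE] l1.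
(* With P the vector of partial sums, P <= A(x) + B(x) P; pairing with v gives (1 - l) (v P) <= v
   A(x), and v_i P_i is one term of v P. *)
exists ((\sum_k v k * asum (A k ord0) x) / (1 - l) / v i) => N.
pose P k := psum (Y k ord0) x N.
have P0 k : 0 <= P k by exact: psum_ge0 (ltW x0).
have PE k : P k <= asum (A k ord0) x + ract (asum_mx B x) P k.
  rewrite /P {1}solution_eq mxE (le_trans (psumD _ _ _ (ltW x0))) // lerD ?psum_le_asum //.
  rewrite mxE (le_trans (psum_sum _ _ _ (ltW x0))) //; apply: ler_sum => j _.
  rewrite (le_trans (psumM _ _ _ (ltW x0))) // ler_wpM2r ?psum_ge0 ?(ltW x0) //.
  exact: psum_le_asum.
rewrite ler_pdivlMr // ler_pdivlMr ?subr_gt0 //.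
apply: le_trans (_ : (\sum_k v k * P k) * (1 - l) <= _).
  rewrite ler_wpM2r ?subr_ge0 ?(ltW l1) // (bigD1 i) //= mulrC lerDl sumr_ge0 // => k _.
  by rewrite mulr_ge0 // ltW.
rewrite mulrBr mulr1 lerBlDr.
apply: le_trans (_ : \sum_k v k * (asum (A k ord0) x + ract (asum_mx B x) P k) <= _).
  by apply: ler_sum => k _; rewrite ler_wpM2l // ltW.
under eq_bigr do rewrite mulrDr.
rewrite big_split lerD2l /= -lact_ract mulrC mulr_sumr.
by apply: ler_sum => k _; rewrite vE mulrA.
Qed.

(** If A = 0, then 0 is a generating function solution, against zero-freeness. *)
Lemma A_neq0 : A != 0.
Proof.
have [_ zf _ _] := irr; apply/eqP => A0.
have /zf /(_ (Ordinal (recursive_dim system_B_recursive))) : gf_solution A B 0.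
  split; last 2 first.
  - by rewrite A0 mulmx0 addr0.
  - have U0 k : lin_U A B k = 0.
      elim: k => [//|k IH] /=; rewrite IH /lin_H mulmx0 addr0 A0.
      by apply/matrixP => i j; rewrite !mxE eval0.
    by rewrite U0; apply/matrixP => i j; rewrite !mxE eval0.
  apply: lt_le_trans (_ : 1%:E <= _)%E; first by rewrite lte_fin.
  apply: le_mx_radius => i j; apply: abscvg_radius => //.
  by rewrite mxE; exact: abscvg_0.
by rewrite mxE eqxx.
Qed.

Lemma critical_not_abscvg x v u : 0 < x -> mx_abscvg B x ->
  perron_pair (asum_mx B x) 1 v u -> ~ (forall i, abscvg (Y i ord0) x).
Proof.
move=> x0 Bx [v0 u0 vE uE] Yx; have x0' := ltW x0.
have Ax i : abscvg (A i ord0) x.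
  apply: (@abscvg_dom (Y i ord0) _ 1 0) => // n.
  rewrite mul1r addn0 le_normc ?system_A_ge0 //.
  exact: solution_geA system_A_ge0 system_B_ge0 system_B0_nilpotent solution_eq i ord0 n.
have nx : normc x%:C = x by rewrite normc_real ger0_norm.
pose y i := asum (Y i ord0) x; pose a i := asum (A i ord0) x.
have yE i : y i = a i + ract (asum_mx B x) y i.
  apply: complexI; rewrite rmorphD rmorph_sum /= -!eval_real //; last 2 first.
  - by move=> n; exact: system_A_ge0.
  - by move=> n; exact: solution_coef_ge0.
  rewrite {1}solution_eq !mxE evalD ?nx //; last first.
    by apply: abscvg_sum => // j _; exact: abscvgM.
  congr (_ + _); rewrite eval_sum ?nx; last by move=> j _; exact: abscvgM.
  apply: eq_bigr => j _; rewrite evalM ?nx // rmorphM /= -!eval_real //.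
  - by move=> n; exact: solution_coef_ge0.
  - by move=> n; exact: system_B_ge0.
have a0 i : 0 <= a i by exact: asum_ge0.
have : \sum_i v i * a i = 0.
  have : \sum_i v i * y i = \sum_i v i * a i + \sum_i v i * y i.
    transitivity (\sum_i (v i * a i + v i * ract (asum_mx B x) y i)).
      by apply: eq_bigr => i _; rewrite {1}yE mulrDr.
    rewrite big_split /= -lact_ract; congr (_ + _).
    by apply: eq_bigr => i _; rewrite vE mul1r.
  by move=> h; apply: (addIr (\sum_i v i * y i)); rewrite -h add0r.
move/eqP; rewrite psumr_eq0; last by move=> i _; rewrite mulr_ge0 // ltW.
move=> /allP va; move/eqP: A_neq0; apply; apply/matrixP => i j; rewrite (ord1 j) mxE.
apply: fpsP => n; apply/eqP; apply: contraT => An.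
have := va i (mem_index_enum i); rewrite mulf_eq0 (gt_eqF (v0 i)) /=.
by rewrite (gt_eqF (asum_gt0 x0 (Ax i) An)).
Qed.

Section AtCriticalPoint.
Variables (r l : R) (v u : 'I_m -> R).
Hypotheses (r0 : 0 < r) (Br : mx_abscvg B r) (pp : perron_pair (asum_mx B r) l v u).
Hypotheses (l1 : l <= 1) (lr : l < 1 -> mx_radius B = r%:E).

Lemma perron_below x : 0 < x -> x <= r -> exists k v u,
  [/\ perron_pair (asum_mx B x) k v u, k <= 1 & k = 1 -> x = r /\ l = 1].
Proof.
move=> x0; rewrite le_eqVlt => /predU1P[->|xr]; first by exists l, v, u.
have Bx : mx_abscvg B x by exact: mx_abscvg_le (ltW x0) (ltW xr) Br.
have [k [v' [u' pk]]] := asum_mx_perron system_B_recursive system_B_connected x0 Bx.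
have kl := asum_mx_perron_lt system_B0_nilpotent system_B_recursive x0 xr Br pk pp.
have k1 := lt_le_trans kl l1.
exists k, v', u'; split => //; first exact: ltW.
by move=> k1'; rewrite k1' ltxx in k1.
Qed.

Lemma mx_radius_solution : mx_radius Y = mine (mx_radius A) r%:E.
Proof.
apply/eqP; rewrite eq_le le_min mx_radius_Y_le_A /=; apply/andP; split.
  have [ll|nl] := boolP (l < 1); first by rewrite -(lr ll) mx_radius_Y_le_B.
  have le1 : l = 1 by apply/eqP; rewrite eq_le l1 leNgt.
  rewrite leNgt; apply/negP => rY.
  move: pp; rewrite le1 => pp1; apply: (critical_not_abscvg r0 Br pp1) => i.
  by apply: lt_mx_radius_abscvg rY; exact: ltW.
apply: le_mx_radius => i j; rewrite (ord1 j); apply: radius_ge => x x0.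
rewrite lt_min lte_fin => /andP[xA xr].
have Bx : mx_abscvg B x by exact: mx_abscvg_le (ltW x0) (ltW xr) Br.
have [k [v' [u' [pk k1 kr]]]] := perron_below x0 (ltW xr).
apply: (subcritical_abscvg _ x0 _ Bx pk).
  by move=> h; apply: lt_mx_radius_abscvg xA; exact: ltW.
rewrite lt_neqAle k1 andbT; apply/eqP => /kr[xr' _].
by rewrite xr' ltxx in xr.
Qed.

Lemma dominant_sing_solution z : dominant_sing Y z ->
  [\/ mx_radius A = mx_radius Y /\ dominant_sing A z,
      mx_radius B = mx_radius Y /\ dominant_sing B z |
      [/\ l = 1, r%:E = mx_radius Y & SigmaC B r z] ].
Proof.
move=> [zY [i0 [j0 nreg]]].
have j00 : j0 = ord0 by exact: ord1.
rewrite {j0}j00 in nreg.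
have [hA|nA] := pselect (mx_radius A = mx_radius Y /\ dominant_sing A z).
  by constructor 1.
have [hB|nB] := pselect (mx_radius B = mx_radius Y /\ dominant_sing B z).
  by constructor 2.
have z0 : 0 < normc z by rewrite -lte_fin zY; have [] := sol.
have zr : normc z <= r by rewrite -lee_fin zY mx_radius_solution ge_min lexx orbT.
(* If the radius of M exceeds that of Y, then z is an interior point; if they are equal, z is not a
   dominant singularity of M. *)
have reg q (M : 'M[fps C]_(m, q)) : (mx_radius Y <= mx_radius M)%E ->
    ~ (mx_radius M = mx_radius Y /\ dominant_sing M z) ->
    forall i j, regular_at (M i j) z.
  move=> YM nM i j; apply: contrapT => nr.
  have [E|nE] := eqVneq (mx_radius M) (mx_radius Y).
    by apply: nM; split => //; split; [rewrite E|exists i, j].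
  apply: nr; apply: regular_inside; rewrite zY.
  by apply: lt_le_trans (mx_radius_le M i j); rewrite lt_neqAle eq_sym nE.
have Bz : mx_abscvg B (normc z) by exact: mx_abscvg_le (ltW z0) zr Br.
have [k [v' [u' [pk k1 kr]]]] := perron_below z0 zr.
have [/det0P[y yn yB]|dn] := boolP (\det (1%:M - mx_eval B z) == 0); last first.
  case: nreg; have regA i := reg _ A mx_radius_Y_le_A nA i ord0.
  have regB := reg _ B mx_radius_Y_le_B nB.
  exact: (solution_regular solution_eq zY z0 mx_radius_Y_le_A mx_radius_Y_le_B
    radius_YE regA regB Bz dn i0).
move: yB; rewrite mulmxBr mulmx1 => /subr0_eq/esym yB.
have [k1' [d d0 dP]] := kernel_phases system_B_ge0 Bz
  (asum_mx_irreducible system_B_connected z0 Bz) pk k1 z0 yn yB.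
have [zr' l1'] := kr k1'.
constructor 3; split => //; first by rewrite -zr'.
have zC0 : (normc z)%:C != 0.
  by rewrite -(rmorph0 (real_complex R)) (inj_eq (@complexI R)) gt_eqF.
have w0 : z / (normc z)%:C != 0.
  by rewrite mulf_neq0 ?invr_eq0 // -normc_eq0 gt_eqF.
have wq := qB_root system_B0_nilpotent w0 d0 dP.
have q0 := qB_gt0 system_B_ge0 system_B0_nilpotent system_B_recursive
  system_B_connected.
have [h hq hE] := root_of_unity_expi q0 wq.
exists h => //; rewrite -hE -zr' mulrCA divff // mulr1 //.
Qed.

End AtCriticalPoint.

End SolutionRadius.

Theorem theorem6p4 (R : realType) (m : nat)
    (A : 'cV[fps R[i]]_m) (B : 'M[fps R[i]]_m) (Y : 'cV[fps R[i]]_m) :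
  irreducible_system A B -> gf_solution A B Y ->
  let rhoA := mx_radius A in
  let rhoB := mx_radius B in
  let rhoY := mx_radius Y in
  let conclusion (rhoC : \bar R) (SC : set R[i]) : Prop :=
    rhoY = mine rhoA (mine rhoB rhoC) /\
    dominant_sing Y `<=`
      [set z | rhoA = rhoY /\ dominant_sing A z] `|`
      [set z | rhoB = rhoY /\ dominant_sing B z] `|`
      [set z | rhoC = rhoY /\ SC z] in
  (subcritical B -> conclusion +oo%E set0) /\
  (~ subcritical B ->
    exists2 rhoC : R, unique (is_rhoC B) rhoC &
      conclusion rhoC%:E (SigmaC B rhoC)).
Proof.
move=> irr sol rhoA rhoB rhoY conclusion.
have b0 := system_B_ge0 irr; have bnil := system_B0_nilpotent irr.
have brec := system_B_recursive irr.
have bconn := system_B_connected irr.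
have rB0 : (0 < mx_radius B)%E by have [[[_ ?] _ _ _] _ _ _] := irr.
split=> [[r [rE Bc [l' lre l'1]]]|nsub].
  (* Here r is the radius of B and the given eigenvalue is the Perron eigenvalue, so l < 1 excludes
     the third kind of singularity. *)
  have r0 : 0 < r by rewrite -lte_fin -rE.
  have Br : mx_abscvg B r by apply/(mx_cvgP b0 (ltW r0)).
  have [l [v [u pp]]] := asum_mx_perron brec bconn r0 Br.
  have ll := largest_real_eigenvalue_unique (asum_mx_largest b0 brec r0 Br pp) lre.
  have l1 : l < 1 by rewrite ll.
  split.
    rewrite /rhoY (mx_radius_solution irr sol r0 Br pp (ltW l1) (fun=> rE)).
    by rewrite /rhoB rE; congr mine; apply/esym/min_idPl; exact: leey.
  move=> z /(dominant_sing_solution irr sol r0 Br pp (ltW l1) (fun=> rE)).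
  case=> [hA|hB|[l1' _ _]]; [by left; left|by left; right|].
  by rewrite l1' ltxx in l1.
have [r [l [v [u [r0 Br pp l1 lr]]]]] := critical_point b0 bnil brec bconn rB0.
have lre := asum_mx_largest b0 brec r0 Br pp.
have rB : (r%:E <= mx_radius B)%E.
  by apply: le_mx_radius => i j; apply: abscvg_radius => //; exact: ltW.
(* If l < 1, then r is the radius of B and the system is subcritical. *)
have l1' : l = 1.
  apply/eqP; rewrite eq_le l1 leNgt; apply/negP => ll; apply: nsub.
  exists r; split; [exact: lr|exact/(mx_cvgP b0 (ltW r0))|].
  by exists l.
exists r.
  split; first by split=> //; [exact/(mx_cvgP b0 (ltW r0))|rewrite -l1'].
  move=> s [s0 sB Bs' slre].
  have Bs : mx_abscvg B s by apply/(mx_cvgP b0 (ltW s0)).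
  have [k [v' [u' pk]]] := asum_mx_perron brec bconn s0 Bs.
  have k1 := largest_real_eigenvalue_unique (asum_mx_largest b0 brec s0 Bs pk) slre.
  apply/eqP; rewrite eq_le !leNgt; apply/andP; split; apply/negP => h.
    by have := asum_mx_perron_lt bnil brec s0 h Br pk pp; rewrite k1 l1' ltxx.
  by have := asum_mx_perron_lt bnil brec r0 h Bs pp pk; rewrite k1 l1' ltxx.
split.
  rewrite /rhoY (mx_radius_solution irr sol r0 Br pp l1 lr).
  by congr mine; apply/esym/min_idPr.
move=> z /(dominant_sing_solution irr sol r0 Br pp l1 lr).
by case=> [hA|hB|[_ rY zC]]; [left; left|left; right|right].
Qed.
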